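(* Let $G$ be a finite abelian group and fix $\epsilon \in (0,1)$. Let $A_1, A_2, \dots, A_n, M, L$ be subsets of $G$. Let $B$ be a regular Bohr set of dimension $d$ and width $\rho$. Suppose that there exists $S\subseteq B$ such that $|A_1+S|\leq K|A_1|$. Let $\sigma=|S|/|B|$ be the density of $S$ in $B$, and suppose that $\sigma > 0$ and $\eta = |M|/|L| \leq 1$. Then there exists a Bohr set $B'\subseteq B$ such that for every $t\in B'$ \[\|1_{A_1}*\cdots *1_{A_n}*1_L*1_M(\cdot + t) - 1_{A_1}*\cdots *1_{A_n}*1_L*1_M\|_{\infty} \leq \epsilon |A_1|\cdots|A_n||M|.\] Furthermore, $B'$ can be taken to have width at least $\rho\epsilon\eta^{1/2}/(d^2d')$ and dimension at most $d+d'$, where \[d'\leq C\bigl(\epsilon^{-2}\log^2(2/(\epsilon\eta))\log(2/\eta)\log(2K)+\log(1/\sigma)\bigr)\] for an absolute constant $C$.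
   Context: For $\Gamma\subseteq\widehat{G}$ (the group of characters of $G$) and $0<\rho\leq 2$, the Bohr set $B=\mathrm{Bohr}(\Gamma,\rho)=\{x\in G: |1-\gamma(x)|\leq\rho \text{ for all }\gamma\in\Gamma\}$; $|\Gamma|$ is its dimension and $\rho$ its width. For $\delta>0$, $B_\delta=\mathrm{Bohr}(\Gamma,\rho\delta)$. A Bohr set $B$ of dimension $d$ is regular if $1-12d|\delta|\leq |B_{1+\delta}|/|B|\leq 1+12d|\delta|$ for every $|\delta|\leq 1/(12d)$. Convolution: $f*g(x)=\sum_{t}f(t)g(x-t)$; $\|f\|_\infty=\max_x|f(x)|$. *)

(* Defs.v *)
From HB Require Import structures.
From mathcomp Require Import all_boot all_order all_algebra.
From mathcomp Require Import reals exp.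
From mathcomp Require Import complex.
Set Implicit Arguments. Unset Strict Implicit. Unset Printing Implicit Defensive.
Import Order.TTheory GRing.Theory Num.Theory.
Local Open Scope ring_scope.
Local Open Scope complex_scope.

Section Defs.
Variables (R : realType) (G : finZmodType).

(* a character of G: a homomorphism G -> C^* (values automatically on the unit circle) *)
Definition is_character (g : {ffun G -> R[i]}) : Prop :=
  g 0 = 1 /\ forall x y, g (x + y) = g x * g y.

Definition Bohr (Gam : seq {ffun G -> R[i]}) (rho : R) : {set G} :=
  [set x | all (fun g : {ffun G -> R[i]} => `|1 - g x| <= rho%:C) Gam].

(* a frequency set: a finite set of characters, represented by a duplicate-free list;
   the dimension is its size *)
Definition freq_set (Gam : seq {ffun G -> R[i]}) : Prop :=
  uniq Gam /\ forall g, g \in Gam -> is_character g.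

Definition regular_Bohr (Gam : seq {ffun G -> R[i]}) (rho : R) : Prop :=
  let d := (size Gam)%:R : R in
  forall delta : R, `|delta| <= 1 / (12 * d) ->
    1 - 12 * d * `|delta| <= #|Bohr Gam (rho * (1 + delta))|%:R / #|Bohr Gam rho|%:R
    /\ #|Bohr Gam (rho * (1 + delta))|%:R / #|Bohr Gam rho|%:R <= 1 + 12 * d * `|delta|.

Definition indic (A : {set G}) : G -> R := fun x => (x \in A)%:R.

Definition conv (f g : G -> R) : G -> R := fun x => \sum_(t : G) f t * g (x - t).

Definition sup_norm (f : G -> R) : R := \big[Num.max/0]_(x : G) `|f x|.

Definition sumset (A B : {set G}) : {set G} := [set a + b | a in A, b in B].

Definition iter_conv (A : nat -> {set G}) (n : nat) (L M : {set G}) : G -> R :=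
  foldr (fun i f => conv (indic (A i)) f) (conv (indic L) (indic M)) (iota 1 n).

End Defs.

(* Main.v *)
Require Import Defs.
From HB Require Import structures.
From mathcomp Require Import all_boot all_order all_algebra.
From mathcomp Require Import fingroup finalg cyclic classfun character algC cyclotomic separable.
From mathcomp Require Import reals sequences exp.
From mathcomp Require Import complex.
From mathcomp Require Import ring lra.
Set Implicit Arguments. Unset Strict Implicit. Unset Printing Implicit Defensive.
Import Order.TTheory GRing.Theory Num.Theory Normc.
Local Open Scope ring_scope.
Local Open Scope complex_scope.

(* Put F = 1_A * 1_L * 1_M with A = A_1; convolving further with the other A_i only
   multiplies errors by their sizes.

   Croot-Sisask: replace A by a random m-tuple of its elements.  Instead of bounding
   L^p moments, one averages the potential sum_x (e^y + e^-y - 2), where y is lam times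
   the sampling error at x; its expectation is at most 2 |L| (1 + lam^2)^m, and convexity
   turns a bound on it into a sup norm bound after convolution with 1_M.  Since |A+S| <= K|A|, some
   tuple serves a proportion K^-m / 2 of the translates in S, giving T included in S such
   that F is almost invariant under T - T, hence close to its average P^k F over
   k (T - T).

   Fourier: P^k multiplies the coefficient at a character g by |1_T^(g)/|T||^(2k), so
   only the g with |1_T^(g)| >= |T|/2 matter, the rest being bounded by Cauchy-Schwarz
   and Parseval.

   Chang relative to B: if Lam is a family of such characters whose nontrivial words with
   exponents in {-1, 0, 1} all have small Fourier coefficient on a small Bohr set B', then
   comparing a Riesz product on T with the same product on B, smoothed |Lam| times by B',
   gives |Lam| = O(log (|B| / |T|)).  For a maximal such Lam every other large character
   is, up to a character that is nearly 1 near 0, a word in Lam. *)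

(** * Orthogonality of characters *)

(** As [n] is invertible, [X^n - 1] is separable, so it has [n] distinct roots, and [n] distinct
    n-th roots of unity include a primitive one. *)
Lemma prim_root_exists (F : closedFieldType) (n : nat) :
  (0 < n)%N -> n%:R != 0 :> F -> exists z : F, n.-primitive_root z.
Proof.
move=> n_gt0 nF; have [r Dp] := closed_field_poly_normal ('X^n - 1 : {poly F}).
rewrite (monicP _) ?monicXnsubC // scale1r in Dp.
have rn1 : all n.-unity_root r by apply/allP=> z; rewrite -root_prod_XsubC -Dp.
have sz_r : (n < (size r).+1)%N.
  by rewrite -(size_prod_XsubC r id) -Dp size_XnsubC.
have [|z zr prz] := hasP (has_prim_root n_gt0 rn1 _ sz_r); last by exists z.
by rewrite -separable_prod_XsubC -Dp separable_Xn_sub_1.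
Qed.

(** Irreducible characters of an abelian group are linear and their kernels intersect trivially. The
    values are still in [algC], not in [R[i]]. *)
Lemma lin_char_separates (G : finZmodType) (x : G) : x != 0 ->
  exists c : G -> algC, [/\ c 0 = 1, (forall y z, c (y + z) = c y * c z) & c x != 1].
Proof.
move=> x0; have /bigcapP xker : x \notin \bigcap_i cfker 'chi[[set: G]%G]_i.
  by rewrite TI_cfker_irr; apply: contra x0 => /set1P ->.
have lin i : 'chi[[set: G]%G]_i \is a linear_char.
  by apply/char_abelianP/FinRing.Theory.zmod_abelian.
have [i xi] : exists i, x \notin cfker 'chi[[set: G]%G]_i.
  apply/existsP; apply: contraT; rewrite negb_exists => /forallP H.
  by case: xker => i _; move: (H i); rewrite negbK.
exists 'chi_i; split.
- exact: (lin_char1 (lin i)).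
- by move=> y z; rewrite -[y + z]/(y * z)%g (lin_charM (lin i)) ?inE.
- by rewrite cfkerEchar ?irr_char // !inE /= lin_char1 ?lin in xi.
Qed.

(** Functions into [R[i]] form no finite type, so the dual group is encoded by homomorphisms into
    the integers modulo [N = #|G|], read as exponents of a primitive root [z]. *)
Lemma dual_orthogonality (R : realType) (G : finZmodType) :
  exists (E : finType) (chi : E -> {ffun G -> R[i]}),
    [/\ (0 < #|E|)%N, forall e, is_character (chi e) &
      forall x, \sum_e chi e x = #|E|%:R * (x == 0)%:R].
Proof.
pose N := #|G|; have N0 : (0 < N)%N by apply/card_gt0P; exists 0.
have [z prz] : exists z : R[i], N.-primitive_root z.
  by apply: prim_root_exists => //; rewrite pnatr_eq0 -lt0n.
pose hom (f : {ffun G -> 'I_N}) :=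
  [forall x, forall y, (f (x + y) : nat) == ((f x + f y) %% N)%N].
pose md n : 'I_N := Ordinal (ltn_pmod n N0).
pose E : finType := {f | hom f}.
pose mk f (fP : hom f) : E := @exist _ (fun f => is_true (hom f)) f fP.
pose chi (e : E) := [ffun x => z ^+ (val e x)].
have chiD e x y : chi e (x + y) = chi e x * chi e y.
  have /forallP/(_ x)/forallP/(_ y)/eqP eD := valP e.
  by rewrite !ffunE eD (prim_expr_mod prz) exprD.
have zn0 m : z ^+ m != 0.
  by rewrite expf_neq0 // (prim_root_eq0 prz) -lt0n.
have chi0 e : chi e 0 = 1.
  have := chiD e 0 0; rewrite addr0 -{1}[chi e 0]mulr1 => /mulfI -> //.
  by rewrite ffunE.
have hom0 : hom [ffun => md 0%N].
  by apply/forallP => x; apply/forallP => y; rewrite !ffunE /= !mod0n.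
have hom_mul (e f : E) : hom [ffun x => md (val e x + val f x)%N].
  apply/forallP => x; apply/forallP => y; rewrite !ffunE /=.
  have /forallP/(_ x)/forallP/(_ y)/eqP -> := valP e.
  have /forallP/(_ x)/forallP/(_ y)/eqP -> := valP f.
  by rewrite !modnDm addnACA.
pose mul (f e : E) : E := mk _ (hom_mul e f).
have mul_chi f e x : chi (mul f e) x = chi e x * chi f x.
  by rewrite !ffunE /= (prim_expr_mod prz) exprD.
have mul_inj f : injective (mul f).
  move=> e e' /(congr1 val)/ffunP ee'; apply/val_inj/ffunP => x.
  have := ee' x; rewrite !ffunE => /(congr1 val) /= /eqP.
  rewrite eqn_modDr !modn_small // => /eqP; exact: val_inj.
(* The values of an [algC]-valued character are N-th roots of unity; their exponents relative to [w]
   are reused with [z]. *)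
have sep x : x != 0 -> exists e, chi e x != 1.
  move=> /lin_char_separates [c [c0 cD cx]].
  have [w prw] := C_prim_root_exists N0.
  have cX y n : c (y *+ n) = c y ^+ n.
    by elim: n => [|n IH]; rewrite ?mulr0n ?c0 ?expr0 // mulrS cD IH exprS.
  have lg y : {k : 'I_N | c y = w ^+ k}.
    apply: (prim_rootP prw); rewrite -cX.
    have := expg_cardG (in_setT y : y \in [set: G]%G).
    by rewrite cardsT FinRing.Theory.zmodXgE => ->; rewrite FinRing.Theory.zmod1gE c0.
  pose f := [ffun y => sval (lg y)].
  have fP y : c y = w ^+ f y by rewrite ffunE; exact: (svalP (lg y)).
  have homf : hom f.
    apply/forallP => y; apply/forallP => y'; rewrite -(modn_small (ltn_ord (f _))).
    by rewrite -(eq_prim_root_expr prw) exprD -!fP cD.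
  exists (mk f homf); rewrite ffunE /=.
  apply: contra cx; rewrite fP -[1 in X in X -> _](expr0 z) -(expr0 w).
  by rewrite (eq_prim_root_expr prz) (eq_prim_root_expr prw).
exists E, chi; split.
- by apply/card_gt0P; exists (mk _ hom0).
- by move=> e; split.
move=> x; have [->|x0] := eqVneq x 0.
  rewrite mulr1 (eq_bigr (fun=> 1)); last by move=> e _; rewrite chi0.
  by rewrite sumr_const.
rewrite mulr0; have [f fx] := sep _ x0; set S := \sum_e _.
(* Multiplying by a character that is not 1 at [x] permutes [E], so the sum is fixed by a factor
   other than 1 and vanishes. *)
have SS : S = S * chi f x.
  rewrite {1}/S (reindex_inj (mul_inj f)) mulr_suml.
  by apply: eq_bigr => e _; rewrite mul_chi.
apply/eqP; move/eqP: SS; rewrite -subr_eq0 -{1}[S]mulr1 -mulrBr mulf_eq0.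
by rewrite subr_eq0 [1 == _]eq_sym (negPf fx) orbF.
Qed.

(** * Characters and Bohr sets *)

Section ComplexNorm.
Variable R : rcfType.
Implicit Types z w : R[i].

Lemma normc_ge0 z : 0 <= normc z.
Proof. by case: z => a b; exact: sqrtr_ge0. Qed.

Lemma normc_realC (x : R) : normc x%:C = `|x|.
Proof. by rewrite /= expr0n addr0 sqrtr_sqr. Qed.

Lemma normc_sum (I : Type) (r : seq I) (P : pred I) (F : I -> R[i]) :
  normc (\sum_(i <- r | P i) F i) <= \sum_(i <- r | P i) normc (F i).
Proof.
elim/big_rec2: _ => [|i y z _ IH]; first by rewrite normc0.
by apply: le_trans (le_normcD _ _) _; rewrite lerD2l.
Qed.

Lemma normc_prod (I : Type) (r : seq I) (P : pred I) (F : I -> R[i]) :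
  normc (\prod_(i <- r | P i) F i) = \prod_(i <- r | P i) normc (F i).
Proof. by elim/big_rec2: _ => [|i y z _ <-]; rewrite ?normc1 ?normcM. Qed.

Lemma normcX z n : normc (z ^+ n) = normc z ^+ n.
Proof. by elim: n => [|n IH]; rewrite ?expr0 ?normc1 // !exprS normcM IH. Qed.

Lemma normc_conj z : normc z^* = normc z.
Proof. by case: z => a b; rewrite /= sqrrN. Qed.

Lemma Re_le_normc z : complex.Re z <= normc z.
Proof.
case: z => a b /=; apply: le_trans (ler_norm a) _; rewrite -sqrtr_sqr.
by apply: ler_wsqrtr; rewrite lerDl sqr_ge0.
Qed.

Lemma normc_unit_conj z : normc z = 1 -> z^* = z^-1.
Proof.
move=> z1; have z0 : z != 0 by apply: contra_eq_neq z1 => ->; rewrite normc0 eq_sym oner_eq0.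
apply: (mulfI z0); rewrite mulfV //; have := sqr_normc z.
by rewrite -[`|z|]/((normc z)%:C) z1 expr1n.
Qed.

Lemma mulcJ_normc z : z * z^* = (normc z ^+ 2)%:C.
Proof. by rewrite -sqr_normc -[`|z|]/((normc z)%:C) -rmorphXn. Qed.

End ComplexNorm.

Section Characters.
Variables (R : realType) (G : finZmodType).
Implicit Types (g w : {ffun G -> R[i]}) (Gam : seq {ffun G -> R[i]}).

Lemma characterMn w x n : is_character w -> w (x *+ n) = w x ^+ n.
Proof.
move=> [w0 wD]; elim: n => [|n IH]; first by rewrite mulr0n.
by rewrite mulrS wD IH exprS.
Qed.

Lemma character_normc w x : is_character w -> normc (w x) = 1.
Proof.
move=> wc; have G0 : (0 < #|G|)%N by apply/card_gt0P; exists 0.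
have : normc (w x) ^+ #|G| = 1.
  rewrite -normcX -characterMn //.
  have := expg_cardG (in_setT x : x \in [set: G]%G).
  by rewrite cardsT FinRing.Theory.zmodXgE => ->; rewrite FinRing.Theory.zmod1gE wc.1 normc1.
by move/eqP; rewrite (pexpr_eq1 G0) ?normc_ge0 // => /eqP.
Qed.

Lemma character_conj w x : is_character w -> (w x)^* = w (- x).
Proof.
move=> wc; rewrite normc_unit_conj ?character_normc //.
have wx0 : w x != 0.
  apply/eqP => wx; have := character_normc x wc; rewrite wx normc0 => /eqP.
  by rewrite eq_sym oner_eq0.
by apply: (mulfI wx0); rewrite mulfV // -wc.2 subrr wc.1.
Qed.

Lemma character_dist_add w x y : is_character w ->
  normc (1 - w (x + y)) <= normc (1 - w x) + normc (1 - w y).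
Proof.
move=> wc; rewrite wc.2.
have -> : 1 - w x * w y = (1 - w x) + w x * (1 - w y) by ring.
apply: le_trans (le_normcD _ _) _.
by rewrite normcM character_normc // mul1r.
Qed.

Lemma character_dist_opp w x : is_character w ->
  normc (1 - w (- x)) = normc (1 - w x).
Proof.
move=> wc; rewrite -character_conj // -[in LHS](conjc1 R) -rmorphB /=.
exact: normc_conj.
Qed.

(** [Bohr] compares complex numbers; [normc] gives the modulus as an element of [R], where linear
    arithmetic applies. *)
Lemma in_Bohr Gam rho x :
  (x \in Bohr Gam rho) = all (fun g : {ffun G -> R[i]} => normc (1 - g x) <= rho) Gam.
Proof. by rewrite inE; apply: eq_all => g; rewrite -lecR. Qed.

Lemma BohrP Gam rho x :
  reflect (forall g, g \in Gam -> normc (1 - g x) <= rho) (x \in Bohr Gam rho).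
Proof. by rewrite in_Bohr; exact: allP. Qed.

Lemma Bohr_le Gam r s : r <= s -> Bohr Gam r \subset Bohr Gam s.
Proof.
move=> rs; apply/subsetP => x /BohrP xr; apply/BohrP => g gG.
exact: le_trans (xr g gG) rs.
Qed.

Lemma Bohr_subseq Gam Gam' r : {subset Gam <= Gam'} -> Bohr Gam' r \subset Bohr Gam r.
Proof. by move=> sub; apply/subsetP => x /BohrP xr; apply/BohrP => g /sub /xr. Qed.

Section FreqSet.
Variable Gam : seq {ffun G -> R[i]}.
Hypothesis Gc : forall g, g \in Gam -> is_character g.

Lemma Bohr0 r : 0 <= r -> 0 \in Bohr Gam r.
Proof. by move=> r0; apply/BohrP => g /Gc[-> _]; rewrite subrr normc0. Qed.

Lemma BohrD r s x y : x \in Bohr Gam r -> y \in Bohr Gam s -> x + y \in Bohr Gam (r + s).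
Proof.
move=> /BohrP xr /BohrP ys; apply/BohrP => g gG.
apply: le_trans (character_dist_add _ _ (Gc gG)) _.
by apply: lerD; [exact: xr|exact: ys].
Qed.

Lemma BohrN r x : (- x \in Bohr Gam r) = (x \in Bohr Gam r).
Proof.
rewrite !in_Bohr; apply: eq_in_all => g gG.
by rewrite character_dist_opp //; exact: Gc.
Qed.

Lemma Bohr_card_gt0 r : 0 <= r -> (0 < #|Bohr Gam r|)%N.
Proof. by move=> r0; apply/card_gt0P; exists 0; exact: Bohr0. Qed.

End FreqSet.
End Characters.

(** * Growth of Bohr sets *)

Section RealLemmas.
Variable R : realType.
Implicit Types x y : R.

Lemma bernoulli_ineq x n : 0 <= x -> 1 + n%:R * x <= (1 + x) ^+ n.
Proof.
move=> x0; elim: n => [|n IH]; first by rewrite mul0r addr0 expr0.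
rewrite exprS; apply: le_trans (ler_wpM2l _ IH); last by rewrite addr_ge0.
rewrite -natr1; have : 0 <= n%:R * x * x by rewrite !mulr_ge0.
by move=> ?; lra.
Qed.

(** Otherwise [b] grows by more than [1 + x] at each of [N] steps, which overshoots the bound at
    [N]. *)
Lemma exists_slow_growth (b : nat -> R) (N : nat) (x C : R) :
  0 <= x -> 0 < b 0%N -> b N <= C * b 0%N -> C < (1 + x) ^+ N ->
  exists2 j, (j < N)%N & b j.+1 <= (1 + x) * b j.
Proof.
move=> x0 b0 bN CN.
case: (boolP [exists j : 'I_N, b j.+1 <= (1 + x) * b j]) => [/existsP[j bj]|].
  by exists (nat_of_ord j).
rewrite negb_exists => /forallP H.
suff /(_ N (leqnn _)) : forall j, (j <= N)%N -> (1 + x) ^+ j * b 0%N <= b j.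
  by move/le_trans/(_ bN); rewrite ler_pM2r // leNgt CN.
elim=> [|j IH] jN; first by rewrite expr0 mul1r.
have := H (Ordinal jN); rewrite -ltNge => /ltW; apply: le_trans => /=.
rewrite exprS -mulrA; apply: ler_wpM2l; first by rewrite addr_ge0.
exact/IH/ltnW.
Qed.

End RealLemmas.

Section BohrGrowth.
Variables (R : realType) (G : finZmodType) (Gam : seq {ffun G -> R[i]}).
Hypothesis Gc : forall g, g \in Gam -> is_character g.

(** The interval from [-r] to [r] is rescaled to length 8 and truncated; the ninth label is for the
    endpoint [u = r]. *)
Let cell (r u : R) : 'I_9 := inord (Num.truncn (u / (r / 4) + 4)).

Lemma cell_close r u v : 0 < r -> `|u| <= r -> `|v| <= r -> cell r u = cell r v ->
  `|u - v| <= r / 4.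
Proof.
move=> r0 ur vr /(congr1 val) /=.
have r4 : 0 < r / 4 by lra.
have bnd (s : R) : `|s| <= r -> 0 <= s / (r / 4) + 4 /\ s / (r / 4) + 4 <= 8.
  rewrite ler_norml => /andP[s1 s2].
  split; first by rewrite -lerBlDr sub0r ler_pdivlMr //; lra.
  by rewrite -lerBrDr ler_pdivrMr //; lra.
have [[u1 u2] [v1 v2]] := (bnd _ ur, bnd _ vr).
have tr (s : R) : 0 <= s -> s <= 8 -> (Num.truncn s < 9)%N.
  by move=> s0 s8; rewrite truncn_lt_nat //; lra.
rewrite !inordK ?tr // => uv.
have /andP[a1 a2] := truncn_itv u1; have /andP[b1 b2] := truncn_itv v1.
rewrite uv in a1 a2.
have n1 := @natr1 R (Num.truncn (v / (r / 4) + 4)); rewrite -n1 in a2 b2.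
have : `|u / (r / 4) - v / (r / 4)| <= 1 by rewrite ler_norml; lra.
have -> : u - v = (u / (r / 4) - v / (r / 4)) * (r / 4) by field; rewrite gt_eqF.
by move=> ?; rewrite normrM (gtr0_norm r4) ler_piMl // ltW.
Qed.

(* Cut the square of side [2 r] around 1 into 81 cells of diameter at most [r / 2]: two points
   of [Bohr Gam r] with the same cell at every frequency differ by a point of [Bohr Gam (r / 2)]. *)
Lemma Bohr_card_half r : 0 < r ->
  (#|Bohr Gam r| <= 81 ^ size Gam * #|Bohr Gam (r / 2)|)%N.
Proof.
move=> r0.
pose code (x : G) : {ffun 'I_(size Gam) -> 'I_9 * 'I_9} :=
  [ffun i => let z := 1 - nth 0 Gam (nat_of_ord i) x in
     (cell r (complex.Re z), cell r (complex.Im z))].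
pose rep c := odflt 0 [pick x in Bohr Gam r | code x == c].
pose f (x : G) := (code x, x - rep (code x)).
have f_inj : injective f by move=> x y [-> ] /addIr.
have : f @: Bohr Gam r \subset setX setT (Bohr Gam (r / 2)).
  apply/subsetP => _ /imsetP[x xB ->]; rewrite inE /= inE /=.
  (* The default 0 is never reached, since [x] itself has the required code. *)
  rewrite /rep; case: pickP => [y /andP[yB /eqP cxy]|/(_ x)]; last first.
    by rewrite xB eqxx.
  apply/BohrP => g gG /=.
  have iG : (index g Gam < size Gam)%N by rewrite index_mem.
  have := congr1 (fun h : {ffun 'I_(size Gam) -> 'I_9 * 'I_9} => h (Ordinal iG)) cxy.
  rewrite !ffunE /= nth_index // => -[].
  have [gc gy] := (Gc gG, character_normc y (Gc gG)).
  have -> : normc (1 - g (x - y)) = normc ((1 - g x) - (1 - g y)).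
    rewrite -[LHS]mul1r -gy -normcM mulrBr mulr1 -gc.2 (addrC y) subrK.
    by congr normc; ring.
  move/BohrP/(_ g gG): xB; move/BohrP/(_ g gG): yB.
  case: (1 - g x) => a b; case: (1 - g y) => c e /= H1 H2.
  have sqr_bound (s t : R) : Num.sqrt (s ^+ 2 + t ^+ 2) <= r -> `|s| <= r /\ `|t| <= r.
    move=> H; split; apply: le_trans H; rewrite -sqrtr_sqr ler_sqrt ?addr_ge0 ?sqr_ge0 //.
      by rewrite lerDl sqr_ge0.
    by rewrite lerDr sqr_ge0.
  have [[ar br] [cr er]] := (sqr_bound _ _ H2, sqr_bound _ _ H1).
  move=> /esym/(cell_close r0 ar cr) ac /esym/(cell_close r0 br er) be.
  have r2 : 0 <= r / 2 by lra.
  rewrite -[leRHS]ger0_norm // -sqrtr_sqr ler_sqrt ?sqr_ge0 //.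
  have sq (s : R) : `|s| <= r / 4 -> s ^+ 2 <= (r / 4) ^+ 2.
    by move=> H; rewrite -[s ^+ 2]ger0_norm ?sqr_ge0 // normrX lerXn2r ?nnegrE //; lra.
  by have [/sq ? /sq ?] := (ac, be); have := sqr_ge0 r; rewrite !expr2 in H1 H2 *; nra.
move=> /subset_leq_card; rewrite card_imset // cardsX cardsT.
by rewrite card_ffun card_prod !card_ord.
Qed.

(* Pigeonhole over [N] equally spaced radii in [[r / 2, r]], using [81 < 2 ^ 7], gives a
   radius at which the Bohr set barely grows. *)
Lemma stable_radius r nu : (0 < size Gam)%N -> 0 < r -> 0 < nu <= 1 ->
  exists2 r1, r / 2 <= r1 <= r &
    forall w : {ffun G -> R[i]}, is_character w ->
      #|Bohr Gam r1|%:R / 2 < normc (\sum_(y in Bohr Gam r1) w y) ->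
      forall t, t \in Bohr Gam (r * nu / (70 * (size Gam)%:R)) -> normc (1 - w t) <= nu.
Proof.
move=> d0 r0 /andP[nu0 nu1]; set d := size Gam in d0 *.
(* [(1 + nu / 4) ^ q >= 2], so over [N = 7 d q] steps the factor exceeds [81 ^ d]. *)
pose q := (Num.truncn (4 / nu)).+1; pose N := (7 * d * q)%N.
have [q1 q2] : 4 / nu < q%:R /\ q%:R <= 5 / nu.
  have /andP[h1 h2] : _ <= 4 / nu < _ := truncn_itv (ltW (divr_gt0 (ltr0n _ 4) nu0)).
  split=> //; rewrite /q -natr1; apply: le_trans (lerD h1 (lexx 1)) _.
  have : 1 <= 1 / nu by rewrite ler_pdivlMr //; lra.
  by move=> ?; lra.
have dR : 0 < d%:R :> R by rewrite ltr0n.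
have qR : 0 < q%:R :> R by rewrite ltr0n.
have N0 : 0 < N%:R :> R by rewrite ltr0n !muln_gt0 d0.
pose rad j : R := r / 2 * (1 + j%:R / N%:R).
pose b j : R := #|Bohr Gam (rad j)|%:R.
have rad_ge0 j : 0 <= rad j.
  by rewrite mulr_ge0 ?addr_ge0 ?divr_ge0 //; lra.
have rad_le i k : (i <= k)%N -> rad i <= rad k.
  by move=> ik; rewrite ler_wpM2l ?lerD2l ?ler_wpM2r ?invr_ge0 ?ler_nat //; lra.
have rad0 : rad 0%N = r / 2 by rewrite /rad mul0r addr0 mulr1.
have radN : rad N = r by rewrite /rad divff ?gt_eqF //; lra.
have [||||j jN bj] := @exists_slow_growth R b N (nu / 4) (81 ^ d)%:R.
- lra.
- by rewrite ltr0n Bohr_card_gt0.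
- by rewrite /b radN rad0 -natrM ler_nat; exact: Bohr_card_half.
- have h2 : 2 <= (1 + nu / 4) ^+ q.
    apply: le_trans (bernoulli_ineq q _); last lra.
    by move: q1; rewrite ltr_pdivrMr // => ?; lra.
  rewrite /N mulnC exprM.
  apply: lt_le_trans (lerXn2r (7 * d)%N _ _ h2); rewrite ?nnegrE ?exprn_ge0 //; try lra.
  by rewrite exprM -natrX natrX ltrXn2r ?gtn_eqF // ?nnegrE -?natrX ?ltr_nat.
exists (rad j).
  by apply/andP; split; [rewrite -rad0 | rewrite -[leRHS]radN]; rewrite rad_le // ltnW.
move=> w wc wbig t tB.
set B1 := Bohr Gam (rad j) in wbig *; set B2 := Bohr Gam (rad j.+1).
have B12 : B1 \subset B2.
  by apply/Bohr_le/rad_le.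
(* Consecutive radii differ by [r / (2 N)], and [q <= 5 / nu] makes this at least [r nu / (70 d)]: a
   shift by [t] stays within the next radius. *)
have tB' : t \in Bohr Gam (r / (2 * N%:R)).
  apply: subsetP tB; apply: Bohr_le.
  rewrite ler_pdivlMr ?mulr_gt0 // mulrAC ler_pdivrMr ?mulr_gt0 //.
  rewrite /N !natrM -!mulrA (ler_wpM2l (ltW r0)) //.
  move: q2; rewrite ler_pdivlMr // => q2.
  have : 0 <= d%:R * (5 - q%:R * nu) by rewrite mulr_ge0 ?subr_ge0 // ltW.
  by move=> ?; lra.
have B1t : [set x + t | x in B1] \subset B2.
  apply/subsetP => _ /imsetP[x xB ->].
  have -> : B2 = Bohr Gam (rad j + r / (2 * N%:R)).
    by congr (Bohr _ _); rewrite /rad -natr1; field; rewrite gt_eqF.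
  exact: BohrD.
have sub_sum (X : {set G}) : X \subset B2 -> #|X| = #|B1| ->
    normc (\sum_(y in B2) w y - \sum_(y in X) w y) <= b j.+1 - b j.
  move=> XB cX; rewrite (big_setID X) /= (setIidPr XB) [X in normc X]addrC addKr.
  apply: le_trans (normc_sum _ _ _) _.
  rewrite (eq_bigr (fun=> 1)); last by move=> y _; rewrite character_normc.
  rewrite sumr_const cardsD (setIidPr XB) cX natrB //.
  exact: subset_leq_card.
have h1 := sub_sum _ B12 erefl.
have h2 := sub_sum _ B1t (card_imset _ (@addIr _ t)).
have sumt : \sum_(y in [set x + t | x in B1]) w y = w t * \sum_(y in B1) w y.
  rewrite big_imset /=; last by move=> x y _ _ /addIr.
  by rewrite mulr_sumr; apply: eq_bigr => x _; rewrite wc.2 mulrC.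
(* [B1] and its translate both lie in [B2], so each sum misses the one over [B2] by at most
   [#|B2| - #|B1|], which is at most [nu / 4] of [#|B1|]. *)
have : normc ((1 - w t) * \sum_(y in B1) w y) <= 2 * (b j.+1 - b j).
  rewrite mulrBl mul1r -sumt.
  set s := \sum_(y in [set _ | _ in _]) _ in h2 *.
  have -> : \sum_(y in B1) w y - s = (\sum_(y in B2) w y - s) - (\sum_(y in B2) w y - \sum_(y in B1) w y).
    ring.
  by apply: le_trans (le_normcD _ _) _; rewrite normcN; lra.
rewrite normcM => H.
have b0 : 0 < b j by rewrite ltr0n Bohr_card_gt0.
have : normc (1 - w t) * (b j / 2) <= 2 * (b j.+1 - b j).
  by apply: le_trans H; rewrite ler_wpM2l ?normc_ge0 // ltW.
move=> {}H; rewrite -(ler_pM2r b0); lra.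
Qed.

End BohrGrowth.

(** * Relative Chang theorem *)

Section ExpLemmas.
Variable R : realType.

(** Squaring [expR (y/2) * (1 - y/2) <= 1] reduces this to [(1 + y + y^2) (1 - y/2)^2 - 1 = (y^2/4)
    (1 - 3y + y^2)], nonnegative in this range. *)
Lemma expR_le_quadratic (y : R) : `|y| <= 1 / 3 -> expR y <= 1 + y + y ^+ 2.
Proof.
rewrite ler_norml => /andP[y1 y2].
have h : expR (y / 2) * (1 - y / 2) <= 1.
  rewrite -[leRHS](expRxMexpNx_1 (y / 2)) ler_wpM2l ?expR_ge0 //.
  exact: expR_ge1Dx.
have -> : expR y = expR (y / 2) ^+ 2 by rewrite expr2 -expRD; congr expR; lra.
have h0 := expR_ge0 (y / 2).
have h2 : (expR (y / 2) * (1 - y / 2)) ^+ 2 <= 1.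
  by rewrite exprn_ile1 // mulr_ge0 //; lra.
have p : 0 < (1 - y / 2) ^+ 2 by rewrite exprn_gt0 //; lra.
rewrite -(ler_pM2r p) -exprMn; apply: le_trans h2 _.
have : 0 <= (y ^+ 2 / 4) * (1 - 3 * y + y ^+ 2).
  by rewrite mulr_ge0 // ?divr_ge0 ?sqr_ge0 //; have := sqr_ge0 y; lra.
by rewrite !expr2; lra.
Qed.

(* Tangent line to [expR] at [c], summed over [X]. *)
Lemma sum_expR_ge (I : finType) (X : {set I}) (F : I -> R) (c : R) :
  #|X|%:R * c <= \sum_(i in X) F i -> #|X|%:R * expR c <= \sum_(i in X) expR (F i).
Proof.
move=> H.
have : \sum_(i in X) expR c * (1 + (F i - c)) <= \sum_(i in X) expR (F i).
  apply: ler_sum => i _; apply: le_trans (ler_wpM2l (expR_ge0 c) (expR_ge1Dx (F i - c))) _.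
  by rewrite -expRD addrC subrK.
apply: le_trans; rewrite -mulr_sumr big_split /= sumr_const sumrB sumr_const.
rewrite mulrC ler_wpM2l ?expR_ge0 // -(mulr_natl c) lerDl subr_ge0.
exact: H.
Qed.

End ExpLemmas.

Section Averaging.
Variables (R : realType) (G : finZmodType) (I : finType) (X : {set I}) (v : I -> G).
Hypothesis X0 : (0 < #|X|)%N.
Implicit Type f : G -> R.

(** The map [v] lets one operator serve for averages over a Bohr set ([v = id]) and over [T - T]
    with multiplicity (pairs and their difference). *)
Definition avg f : G -> R := fun x => (\sum_(i in X) f (x + v i)) / #|X|%:R.

Let XR : 0 < #|X|%:R :> R. Proof. by rewrite ltr0n. Qed.

Lemma avg_ge0 f : (forall x, 0 <= f x) -> forall x, 0 <= avg f x.
Proof. by move=> f0 x; rewrite divr_ge0 ?sumr_ge0 // => i _. Qed.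

(** Characters are eigenfunctions of [avg], the eigenvalue being the mean of the character over the
    shifts. *)
Lemma iter_avg_trig (J : finType) (c : J -> R[i]) (w : J -> {ffun G -> R[i]}) f k :
  (forall j, is_character (w j)) ->
  (forall x, (f x)%:C = \sum_j c j * w j x) ->
  forall x, (iter k (avg) f x)%:C =
    \sum_j c j * ((\sum_(i in X) w j (v i)) / #|X|%:R) ^+ k * w j x.
Proof.
move=> wc fE; elim: k => [|k IH] x /=.
  by rewrite fE; apply: eq_bigr => j _; rewrite expr0 mulr1.
rewrite /avg rmorphM rmorph_sum fmorphV /= rmorph_nat.
under eq_bigr do rewrite IH.
rewrite exchange_big mulr_suml; apply: eq_bigr => j _ /=.
under eq_bigr do rewrite (wc j).2.
rewrite -mulr_sumr -mulr_sumr exprSr.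
by ring.
Qed.

Lemma iter_avg_dist f e k : (forall x i, i \in X -> `|f (x + v i) - f x| <= e) ->
  forall x, `|iter k avg f x - f x| <= k%:R * e.
Proof.
have avgE h (x : G) y : avg h x - y = (\sum_(i in X) (h (x + v i) - y)) / #|X|%:R.
  by rewrite sumrB sumr_const mulrBl -(mulr_natr y) mulfK ?gt_eqF.
move=> fe; elim: k => [|k IH] x; first by rewrite /= subrr normr0 mul0r.
rewrite /= avgE normrM [`|_^-1|]ger0_norm ?invr_ge0 // ler_pdivrMr //.
apply: le_trans (ler_norm_sum _ _ _) _.
apply: le_trans (_ : \sum_(i in X) k.+1%:R * e <= _); last first.
  by rewrite sumr_const mulr_natr.
apply: ler_sum => i iX; rewrite -natr1 mulrDl mul1r.
have -> : iter k avg f (x + v i) - f x =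
  (iter k avg f (x + v i) - f (x + v i)) + (f (x + v i) - f x) by ring.
by apply: le_trans (ler_normD _ _) _; apply: lerD; [exact: IH|exact: fe].
Qed.

End Averaging.

Section BohrAveraging.
Variables (R : realType) (G : finZmodType) (Gam : seq {ffun G -> R[i]}).
Hypothesis Gc : forall g, g \in Gam -> is_character g.

(** For each shift in [Bohr Gam kap] the shifted larger ball still covers the smaller one, and [f]
    is nonnegative; so each smoothing costs only [kap] in the radius. *)
Lemma Bohr_sum_le_iter_avg (f : G -> R) (r kap : R) (k : nat) :
  0 <= kap -> (forall x, 0 <= f x) ->
  \sum_(x in Bohr Gam r) f x <=
  \sum_(x in Bohr Gam (r + k%:R * kap)) iter k (avg (Bohr Gam kap) id) f x.
Proof.
move=> kap0 f0; have B0 : (0 < #|Bohr Gam kap|)%N by apply: Bohr_card_gt0.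
have BR : 0 < #|Bohr Gam kap|%:R :> R by rewrite ltr0n.
have step (h : G -> R) s : (forall x, 0 <= h x) -> \sum_(x in Bohr Gam s) h x <=
    \sum_(x in Bohr Gam (s + kap)) avg (Bohr Gam kap) id h x.
  move=> h0; rewrite -mulr_suml ler_pdivlMr // exchange_big /=.
  rewrite mulr_natr -sumr_const; apply: ler_sum => y yB.
  rewrite (reindex_inj (addIr y)) /= big_mkcond [leRHS]big_mkcond /=.
  apply: ler_sum => z _; case: ifP => [zy|_]; last by case: ifP.
  by rewrite -(addrK y z) (BohrD Gc zy) // BohrN.
elim: k => [|k IH]; first by rewrite mul0r addr0.
apply: le_trans IH _; rewrite -natr1 mulrDl mul1r addrA /=; apply: step.
by elim: k => [|k IHk] x //=; exact: avg_ge0.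
Qed.

End BohrAveraging.

Section Chang.
Variables (R : realType) (G : finZmodType) (E : finType) (chi : E -> {ffun G -> R[i]}).
Hypothesis chi_char : forall e, is_character (chi e).

(* Exponents [0, 1, 2 : 'I_3] stand for [0, 1, -1]. *)
Definition tri (i : 'I_3) (z : R[i]) : R[i] :=
  if i == 0 :> nat then 1 else if i == 1 :> nat then z else z^*.

Definition word (Lam : {set E}) (m : {ffun E -> 'I_3}) : {ffun G -> R[i]} :=
  [ffun x => \prod_(e in Lam) tri (m e) (chi e x)].

(** An analytic form of dissociativity relative to [X]: nontrivial words must lose half of the mass
    of [X], rather than merely differ from the trivial character. *)
Definition dissociated (X : {set G}) (Lam : {set E}) : bool :=
  [forall m : {ffun E -> 'I_3}, [exists e in Lam, m e != ord0] ==>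
    (normc (\sum_(y in X) word Lam m y) <= #|X|%:R / 2)].

Lemma tri_word_char Lam m : is_character (word Lam m).
Proof.
split=> [|x y]; rewrite !ffunE.
  by rewrite big1 // => e _; rewrite /tri (chi_char e).1 (conjc1 R) !if_same.
rewrite -big_split /=; apply: eq_bigr => e _; rewrite /tri (chi_char e).2 rmorphM /=.
by case: ifP => _; [rewrite mulr1 | case: ifP].
Qed.

Lemma Re_sum (I : Type) (r : seq I) (P : pred I) (F : I -> R[i]) :
  complex.Re (\sum_(i <- r | P i) F i) = \sum_(i <- r | P i) complex.Re (F i).
Proof. by elim/big_rec2: _ => [|i y z _ <-] //; case: (F i) z => [? ?] []. Qed.

Lemma phase_exists (z : R[i]) :
  exists c : R[i], normc c = 1 /\ complex.Re (c * z) = normc z.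
Proof.
have [->|z0] := eqVneq z 0; first by exists 1; rewrite normc1 mulr0 normc0.
have n0 : normc z != 0 by apply: contra z0 => /eqP/eq0_normc ->.
exists (((normc z)^-1)%:C * z^*); split.
  rewrite normcM normc_realC normc_conj ger0_norm ?invr_ge0 ?normc_ge0 //.
  by rewrite mulVf.
rewrite -mulrA [_^* * _]mulrC mulcJ_normc -rmorphM /= expr2 mulrA mulVf //.
by rewrite mul1r.
Qed.

(* The Riesz product [Q] is a sum of words; after averaging [k] times over [Bohr Gam kap] each
   nontrivial word has lost a factor [2 ^ k], and there are few enough of them for the
   constant term to dominate. *)
Lemma chang_bound (Gam : seq {ffun G -> R[i]}) (rho kap : R) (k : nat)
  (T : {set G}) (Lam : {set E}) :
  (forall g, g \in Gam -> is_character g) -> 0 <= kap ->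
  #|Bohr Gam (rho + k%:R * kap)|%:R <= 2 * #|Bohr Gam rho|%:R :> R ->
  T \subset Bohr Gam rho ->
  (forall e, e \in Lam -> (#|T|%:R / 2 : R) <= normc (\sum_(x in T) chi e x)) ->
  dissociated (Bohr Gam kap) Lam -> (#|Lam| <= k)%N ->
  (#|T|%:R : R) * expR (#|Lam|%:R / 16) <= 4 * #|Bohr Gam rho|%:R.
Proof.
move=> Gc kap0 reg TB spec dis Lk.
have [c cP] : exists c : E -> R[i], forall e, normc (c e) = 1 /\
    complex.Re (c e * \sum_(x in T) chi e x) = normc (\sum_(x in T) chi e x).
  by apply: (fin_all_exists (fun e => phase_exists (\sum_(x in T) chi e x))).
pose u e x := complex.Re (c e * chi e x).
have u1 e x : `|u e x| <= 1.
  rewrite ler_norml; apply/andP; split.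
    rewrite lerNl /u.
    have -> : - complex.Re (c e * chi e x) = complex.Re (- (c e * chi e x)).
      by case: (c e * chi e x).
    apply: le_trans (Re_le_normc _) _.
    by rewrite normcN normcM (cP e).1 character_normc // mulr1.
  by apply: le_trans (Re_le_normc _) _; rewrite normcM (cP e).1 character_normc // mulr1.
(* The factor is chosen because [expR (u/4) <= 1 + u/4 + u^2/16 <= 17/16 + u/4] when [|u| <= 1]. *)
pose Q x : R := \prod_(e in Lam) (17 / 16 + u e x / 4).
have factor_ge0 e x : 0 <= 17 / 16 + u e x / 4.
  by have := u1 e x; rewrite ler_norml => /andP[]; lra.
have Q0 x : 0 <= Q x by apply: prodr_ge0.
have lower : #|T|%:R * expR (#|Lam|%:R / 8) <= \sum_(x in T) Q x.
  apply: le_trans (_ : \sum_(x in T) expR (\sum_(e in Lam) u e x / 4) <= _).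
    apply: sum_expR_ge; rewrite exchange_big /=.
    apply: le_trans (_ : \sum_(e in Lam) #|T|%:R / 8 <= _).
      by rewrite sumr_const -mulr_natl; lra.
    apply: ler_sum => e eL; rewrite -mulr_suml /u -Re_sum -mulr_sumr (cP e).2.
    by have := spec e eL; lra.
  apply: ler_sum => x _; rewrite expR_sum; apply: ler_prod => e _.
  rewrite expR_ge0 /=; have := u1 e x => /[dup]; rewrite {1}ler_norml => /andP[a1 a2] a.
  apply: le_trans (expR_le_quadratic _) _.
    by rewrite normrM [X in _ * X]ger0_norm //; lra.
  have : u e x ^+ 2 <= 1 by rewrite -[leLHS]ger0_norm ?sqr_ge0 // normrX exprn_ile1.
  by rewrite !expr2; lra.
pose a e (i : 'I_3) : R[i] := if i == 0 :> nat then (17 / 16)%:C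
  else if i == 1 :> nat then c e / 8 else (c e)^* / 8.
(* [b] kills every [m] that is nonzero off [Lam], so each choice of exponents on [Lam] is counted
   once. *)
pose b e (i : 'I_3) : R[i] := if e \in Lam then a e i else (i == ord0)%:R.
pose C (m : {ffun E -> 'I_3}) := \prod_e b e (m e).
have QE x : (Q x)%:C = \sum_m C m * word Lam m x.
  rewrite /Q rmorph_prod big_mkcond /=.
  transitivity (\prod_e \sum_(i < 3) b e i * (if e \in Lam then tri i (chi e x) else 1)).
    apply: eq_bigr => e _; rewrite !big_ord_recl big_ord0 /b /a /tri /=.
    case: ifP => _; last by rewrite !mul0r !addr0 mulr1.
    rewrite rmorphD /= mulr1 addr0; congr (_ + _).
    have -> : c e / 8 * chi e x + (c e)^* / 8 * (chi e x)^* =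
       (c e * chi e x + (c e * chi e x)^*) / 8 by rewrite rmorphM /=; ring.
    rewrite addcJ rmorphM fmorphV /= rmorph_nat.
    by field.
  rewrite bigA_distr_bigA /=; apply: eq_bigr => m _.
  by rewrite big_split /= ffunE [in RHS]big_mkcond.
(* Each frequency contributes [17/16 + 1/8 + 1/8]. As [21/16 <= 2] and [#|Lam| <= k], dividing by
   [2 ^ k] later brings this sum below 1. *)
have sumC : \sum_m normc (C m) = (21 / 16) ^+ #|Lam|.
  under eq_bigr do rewrite normc_prod.
  rewrite -(bigA_distr_bigA (fun e i => normc (b e i))) /=.
  rewrite -prodr_const [RHS]big_mkcond /=; apply: eq_bigr => e _.
  rewrite !big_ord_recl big_ord0 /b /a /=; case: ifP => _.
    have n8 : normc (8^-1 : R[i]) = 8^-1.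
      have -> : (8^-1 : R[i]) = (8^-1)%:C by rewrite fmorphV /= rmorph_nat.
      by rewrite normc_realC ger0_norm ?invr_ge0.
    rewrite [normc (_%:C)]normc_realC !normcM normc_conj (cP e).1 n8.
    by rewrite ger0_norm //; lra.
  by rewrite normc1 normc0; lra.
have C0 : normc (C [ffun=> ord0]) = (17 / 16) ^+ #|Lam|.
  rewrite normc_prod -prodr_const [RHS]big_mkcond; apply: eq_bigr => e _ /=.
  rewrite ffunE /b /a eqxx; case: ifP => _; last exact: (@normc1 R).
  have p : 0 <= 17 / 16 :> R by lra.
  by rewrite -[RHS](ger0_norm p) -normc_realC.
set B' := Bohr Gam kap in dis; set Bk := Bohr Gam (rho + k%:R * kap) in reg.
have B'0 : (0 < #|B'|)%N by apply: Bohr_card_gt0.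
have B'R : 0 < #|B'|%:R :> R by rewrite ltr0n.
pose mu m := (\sum_(y in B') word Lam m y) / #|B'|%:R.
have nmu m : normc (mu m) = normc (\sum_(y in B') word Lam m y) / #|B'|%:R.
  by rewrite normcM normcV -[#|B'|%:R in LHS](rmorph_nat (real_complex R)) normc_realC ger0_norm.
have card_norm m (Y : {set G}) : normc (\sum_(x in Y) word Lam m x) <= #|Y|%:R.
  apply: le_trans (normc_sum _ _ _) _; rewrite -sumr_const; apply: ler_sum => x _.
  by rewrite character_normc //; exact: tri_word_char.
have term m : normc (C m * mu m ^+ k) <=
    (if m == [ffun=> ord0] then (17 / 16) ^+ #|Lam| else 0) + normc (C m) / 2 ^+ k.
  rewrite normcM normcX.
  have [->|m0] := eqVneq m [ffun=> ord0].
    have p : 0 <= 17 / 16 :> R by lra.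
    rewrite C0 -[leLHS]addr0; apply: lerD; last by rewrite divr_ge0 ?exprn_ge0.
    rewrite -[leRHS]mulr1; apply: ler_wpM2l; first by rewrite exprn_ge0 //; lra.
    apply: exprn_ile1; first exact: normc_ge0.
    by rewrite nmu ler_pdivrMr // mul1r.
  rewrite add0r.
  case: (boolP [exists e in Lam, m e != ord0]) => [ex|nex].
    rewrite -exprVn ler_wpM2l ?normc_ge0 // lerXn2r ?nnegrE ?normc_ge0 ?invr_ge0 //.
    rewrite nmu ler_pdivrMr // mulrC.
    by move/forallP: dis => /(_ m)/implyP/(_ ex).
  suff -> : C m = 0 by rewrite normc0 !mul0r.
  have [e me] : exists e, m e != ord0.
    apply/existsP; apply: contraR m0; rewrite negb_exists => /forallP H.
    by apply/eqP/ffunP => e; rewrite ffunE; apply/eqP; move: (H e); rewrite negbK.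
  have eL : e \in Lam = false.
    apply: contraNF nex => eL; apply/existsP; exists e; by rewrite eL.
  by rewrite /C (bigD1 e) //= /b eL (negPf me) mul0r.
have upper : \sum_(x in Bohr Gam rho) Q x <= 2 * (17 / 16) ^+ #|Lam| * #|Bk|%:R.
  apply: le_trans (Bohr_sum_le_iter_avg Gc rho k kap0 Q0) _; rewrite -/Bk -/B'.
  set s := \sum_(x in Bk) _.
  have sE : s%:C = \sum_m C m * mu m ^+ k * \sum_(x in Bk) word Lam m x.
    rewrite rmorph_sum /=.
    under eq_bigr do rewrite (iter_avg_trig B' id k (tri_word_char Lam) QE).
    by rewrite exchange_big; apply: eq_bigr => m _; rewrite /= -mulr_sumr.
  apply: le_trans (ler_norm s) _; rewrite -normc_realC sE.
  apply: le_trans (normc_sum _ _ _) _.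
  apply: le_trans (_ : \sum_m normc (C m * mu m ^+ k) * #|Bk|%:R <= _).
    by apply: ler_sum => m _; rewrite normcM ler_wpM2l ?normc_ge0.
  rewrite -mulr_suml ler_wpM2r //; apply: le_trans (ler_sum _ (fun m _ => term m)) _.
  rewrite big_split /= -big_mkcond big_pred1_eq -mulr_suml sumC.
  rewrite [leRHS](_ : _ = (17 / 16) ^+ #|Lam| + (17 / 16) ^+ #|Lam|); last lra.
  rewrite lerD2l.
  apply: le_trans (_ : 1 <= _); last by rewrite exprn_ege1 //; lra.
  rewrite ler_pdivrMr ?exprn_gt0 // mul1r.
  apply: le_trans (ler_weXn2l _ Lk); last lra.
  by rewrite lerXn2r ?nnegrE //; lra.
(* The lower bound has exponent [#|Lam| / 8] and the upper one only [#|Lam| / 16]; the difference is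
   the gain. *)
have e17 : (17 / 16) ^+ #|Lam| <= expR (#|Lam|%:R / 16) :> R.
  rewrite expRM_natl lerXn2r ?nnegrE ?expR_ge0 //; first lra.
  by have := expR_ge1Dx (16^-1 : R); lra.
have e8 : expR (#|Lam|%:R / 8) = expR (#|Lam|%:R / 16) * expR (#|Lam|%:R / 16) :> R.
  by rewrite -expRD; congr expR; lra.
have TQ : \sum_(x in T) Q x <= \sum_(x in Bohr Gam rho) Q x.
  rewrite big_mkcond [leRHS]big_mkcond; apply: ler_sum => x _.
  by case: ifP => [/(subsetP TB)->//|_]; case: ifP.
have e0 : 0 < expR (#|Lam|%:R / 16) :> R by apply: expR_gt0.
rewrite -(ler_pM2r e0) -mulrA -e8; apply: le_trans (le_trans lower (le_trans TQ upper)) _.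
apply: le_trans (_ : 2 * expR (#|Lam|%:R / 16) * (2 * #|Bohr Gam rho|%:R) <= _); last lra.
by apply: ler_pM; rewrite ?mulr_ge0 ?exprn_ge0 ?ler_wpM2l //; lra.
Qed.

End Chang.

Lemma normc_sub1_prod (R : rcfType) (I : Type) (r : seq I) (P : pred I) (F : I -> R[i]) :
  (forall i, normc (F i) = 1) ->
  normc (1 - \prod_(i <- r | P i) F i) <= \sum_(i <- r | P i) normc (1 - F i).
Proof.
move=> F1; elim/big_rec2: _ => [|i y z _ IH]; first by rewrite subrr normc0.
have -> : 1 - F i * z = (1 - F i) + F i * (1 - z) by ring.
apply: le_trans (le_normcD _ _) _.
by rewrite normcM F1 mul1r lerD2l.
Qed.

Section Spectrum.
Variables (R : realType) (G : finZmodType) (E : finType) (chi : E -> {ffun G -> R[i]}).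
Hypothesis chi_char : forall e, is_character (chi e).

Lemma tri_normc i (z : R[i]) : normc z = 1 -> normc (tri i z) = 1.
Proof.
move=> z1; rewrite /tri; case: ifP => _; first by rewrite normc1.
by case: ifP => _; rewrite ?normc_conj.
Qed.

Lemma tri_dist i (z : R[i]) : normc (1 - tri i z) <= normc (1 - z).
Proof.
rewrite /tri; case: ifP => _; first by rewrite subrr normc0 normc_ge0.
by case: ifP => _ //; rewrite -[in leLHS](conjc1 R) -rmorphB /= normc_conj.
Qed.

Lemma tri_dist_neq0 i (z : R[i]) : i != ord0 -> normc (1 - tri i z) = normc (1 - z).
Proof.
rewrite /tri -val_eqE /= => /negPf ->.
by case: ifP => _ //; rewrite -[in LHS](conjc1 R) -rmorphB /= normc_conj.
Qed.

(** [Lam] is maximal among dissociated sets of at most [k] large characters. A further large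
    character creates a word with large coefficient at a stable radius; that word is within [nu] of
    1 at [t], and its factors from [Lam] cost another [nu]. *)
Lemma chang_spectrum (Gam : seq {ffun G -> R[i]}) (rho nu : R) (k : nat) (T : {set G}) :
  let d : R := (size Gam)%:R in
  (forall g, g \in Gam -> is_character g) -> (0 < size Gam)%N -> 0 < rho ->
  #|Bohr Gam (rho * (1 + 1 / (12 * d)))|%:R <= 2 * #|Bohr Gam rho|%:R :> R ->
  T \subset Bohr Gam rho -> (0 < k)%N ->
  4 * #|Bohr Gam rho|%:R < (#|T|%:R : R) * expR (k%:R / 16) ->
  0 < nu <= 1 ->
  exists2 Lam : {set E}, (#|Lam| <= k)%N &
    forall e t, (#|T|%:R / 2 : R) <= normc (\sum_(x in T) chi e x) ->
      t \in Bohr Gam (rho * nu / (840 * d ^+ 2 * k%:R)) ->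
      (forall l, l \in Lam -> normc (1 - chi l t) <= nu / k%:R) ->
      normc (1 - chi e t) <= 2 * nu.
Proof.
move=> d Gc d0 rho0 reg TB k0 Tbig nu01.
have dR : 0 < d by rewrite ltr0n.
have kR : 0 < k%:R :> R by rewrite ltr0n.
(* With this radius, [k] smoothings stay within the dilate of [Bohr Gam rho] controlled by the
   doubling hypothesis. *)
have r0 : 0 < rho / (12 * d * k%:R) by rewrite divr_gt0 ?mulr_gt0.
have [kap /andP[kap1 kap2] stab] := stable_radius Gc d0 r0 nu01.
have kap0 : 0 <= kap by apply: le_trans kap1; rewrite divr_ge0 // ltW.
have regk : #|Bohr Gam (rho + k%:R * kap)|%:R <= 2 * #|Bohr Gam rho|%:R :> R.
  apply: le_trans reg; rewrite ler_nat; apply/subset_leq_card/Bohr_le.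
  have -> : rho * (1 + 1 / (12 * d)) = rho + k%:R * (rho / (12 * d * k%:R)).
    by field; rewrite !gt_eqF.
  by rewrite lerD2l ler_wpM2l.
pose spec e := (#|T|%:R / 2 : R) <= normc (\sum_(x in T) chi e x).
pose P (Lam : {set E}) := [&& [forall e in Lam, spec e],
  dissociated chi (Bohr Gam kap) Lam & (#|Lam| <= k)%N].
have P0 : P set0.
  apply/and3P; split; last by rewrite cards0.
    by apply/forallP => e; rewrite inE.
  apply/forallP => m; apply/implyP => /existsP[e]; by rewrite inE.
have [Lam /maxsetP[/and3P[/forallP specL disL Lk] maxL] _] := maxset_exists P0.
exists Lam => // e t spece tB tL.
have /andP[nu0 nu1] := nu01.
(* [chang_bound] excludes [#|Lam| = k], so adding [e] respects the size limit and can only break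
   dissociativity. *)
have {Lk} Lk : (#|Lam| < k)%N.
  rewrite ltn_neqAle Lk andbT; apply: contraTneq Tbig => Lk'.
  rewrite -leNgt -Lk'; apply: (chang_bound chi_char Gc kap0 regk TB _ disL).
    by move=> l lL; have /implyP := specL l; apply.
  by rewrite Lk'.
have nuk : nu / k%:R <= nu.
  by rewrite ler_pdivrMr // ler_peMr ?ler1n // ltW.
case: (boolP (e \in Lam)) => eL; first by have := tL e eL; lra.
have : ~~ P (e |: Lam).
  apply/negP => /maxL /(_ (subsetUr _ _)) eq; move: eL; rewrite -eq.
  by rewrite setU11.
rewrite /P cardsU1 eL Lk andbT negb_and => /orP[|].
  move/negP; case; apply/forallP => l; apply/implyP; rewrite in_setU1.
  by case/orP => [/eqP-> //|lL]; have /implyP := specL l; apply.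
rewrite negb_forall => /existsP[m]; rewrite negb_imply -ltNge => /andP[ex big].
have wE : word chi (e |: Lam) m =
    [ffun x => tri (m e) (chi e x) * word chi Lam m x].
  by apply/ffunP => x; rewrite !ffunE big_setU1.
have unit l x : normc (tri (m l) (chi l x)) = 1.
  by apply: tri_normc; exact: character_normc.
(* If [e] has exponent 0, the large word already lives on [Lam], against [disL]. *)
case: (eqVneq (m e) ord0) => [me|me].
  have exL : [exists e0 in Lam, m e0 != ord0].
    case/existsP: ex => l /andP[]; rewrite in_setU1 => /orP[/eqP->|lL ml].
      by rewrite me eqxx.
    by apply/existsP; exists l; rewrite lL.
  have /forallP/(_ m)/implyP/(_ exL) := disL.
  rewrite leNgt => /negP; case; move: big; rewrite wE.
  by under eq_bigr do rewrite ffunE /tri me mul1r.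
have tB' : t \in Bohr Gam (rho / (12 * d * k%:R) * nu / (70 * (size Gam)%:R)).
  rewrite -/d; apply: subsetP tB; apply: Bohr_le.
  rewrite le_eqVlt; apply/orP; left; apply/eqP.
  by field; rewrite !gt_eqF.
have := stab _ (tri_word_char chi_char _ _) big t tB'.
rewrite wE ffunE -(tri_dist_neq0 (chi e t) me).
set a := tri _ _; set w := word chi Lam m t => H.
have -> : 1 - a = (1 - a * w) + (- a) * (1 - w) by ring.
apply: le_trans (le_normcD _ _) _; rewrite normcM normcN unit mul1r.
suff : normc (1 - w) <= nu by lra.
rewrite /w ffunE; apply: le_trans (normc_sub1_prod _ _ _) _ => //.
apply: le_trans (_ : \sum_(l in Lam) nu / k%:R <= _).
  by apply: ler_sum => l lL; apply: le_trans (tri_dist _ _) _; exact: tL.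
rewrite sumr_const -[leLHS]mulr_natr mulrAC ler_pdivrMr //.
by rewrite (ler_wpM2l (ltW nu0)) // ler_nat ltnW.
Qed.

End Spectrum.

(** * Fourier analysis of smoothed convolutions *)

Section Convolution.
Variables (R : realType) (G : finZmodType).

Lemma conv_indicE (A : {set G}) (f : G -> R) x :
  conv (indic R A) f x = \sum_(a in A) f (x - a).
Proof.
rewrite /conv [RHS]big_mkcond /=; apply: eq_bigr => a _.
by rewrite /indic; case: (a \in A); rewrite ?mul1r ?mul0r.
Qed.

End Convolution.

Section Fourier.
Variables (R : realType) (G : finZmodType) (E : finType) (chi : E -> {ffun G -> R[i]}).
Hypothesis E0 : (0 < #|E|)%N.
Hypothesis chi_char : forall e, is_character (chi e).
Hypothesis chi_orth : forall x, \sum_e chi e x = #|E|%:R * (x == 0)%:R.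

Let ER : #|E|%:R != 0 :> R[i]. Proof. by rewrite pnatr_eq0 -lt0n. Qed.

Definition fourier (X : {set G}) e : R[i] := \sum_(x in X) chi e (- x).

Lemma conv_indic_trig (A : {set G}) (f : G -> R) (c : E -> R[i]) :
  (forall x, (f x)%:C = \sum_e c e * chi e x) ->
  forall x, (conv (indic R A) f x)%:C = \sum_e (fourier A e * c e) * chi e x.
Proof.
move=> fE x; rewrite conv_indicE rmorph_sum /=.
under eq_bigr do rewrite fE.
rewrite exchange_big; apply: eq_bigr => e _ /=.
rewrite -mulrA mulr_suml; apply: eq_bigr => a _.
by rewrite (chi_char e).2; ring.
Qed.

Lemma indic_trig (M : {set G}) x :
  (indic R M x)%:C = \sum_e (fourier M e / #|E|%:R) * chi e x.
Proof.
have -> : \sum_e (fourier M e / #|E|%:R) * chi e x =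
    \sum_(y in M) (\sum_e chi e (x - y)) / #|E|%:R.
  transitivity (\sum_e \sum_(y in M) chi e (x - y) / #|E|%:R).
    apply: eq_bigr => e _; rewrite /fourier !mulr_suml; apply: eq_bigr => y _.
    by rewrite (chi_char e).2; ring.
  by rewrite exchange_big; apply: eq_bigr => y _; rewrite mulr_suml.
transitivity (\sum_(y in M) ((x == y)%:R : R[i])); last first.
  by apply: eq_bigr => y _; rewrite chi_orth subr_eq0 mulrAC mulfV // mul1r.
rewrite /indic rmorph_nat big_mkcond (bigD1 x) //= eqxx big1 ?addr0.
  by case: ifP.
by move=> y; rewrite eq_sym => /negPf ->; case: ifP.
Qed.

Lemma parseval (X : {set G}) : \sum_e normc (fourier X e) ^+ 2 = #|E|%:R * #|X|%:R.
Proof.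
apply: (@complexI R); rewrite rmorph_sum rmorphM /= !rmorph_nat.
under eq_bigr do rewrite -mulcJ_normc.
transitivity (\sum_e \sum_(x in X) \sum_(y in X) chi e (y - x)).
  apply: eq_bigr => e _; rewrite /fourier rmorph_sum mulr_suml.
  apply: eq_bigr => x _; rewrite mulr_sumr; apply: eq_bigr => y _.
  transitivity (chi e (- x) * conjc (chi e (- y))) => //.
  by rewrite character_conj // opprK -(chi_char e).2 addrC.
rewrite exchange_big /= mulr_natr -sumr_const; apply: eq_bigr => x xX.
rewrite exchange_big /= (bigD1 x) //= chi_orth subrr eqxx mulr1 big1 ?addr0 //.
by move=> y /andP[_ yx]; rewrite chi_orth subr_eq0 (negPf yx) mulr0.
Qed.

(** The weighted inequality [2 a b <= th a^2 + b^2 / th] with Parseval; [th = sqrt (#|M| / #|L|)]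
    recovers the usual bound. *)
Lemma cauchy_schwarz_fourier (L M : {set G}) (th : R) : 0 < th ->
  \sum_e normc (fourier L e) * normc (fourier M e) <=
    #|E|%:R * ((th * #|L|%:R + #|M|%:R / th) / 2).
Proof.
move=> th0.
apply: le_trans (_ : \sum_e (th * normc (fourier L e) ^+ 2 + normc (fourier M e) ^+ 2 / th) / 2 <= _).
  apply: ler_sum => e _; set a := normc _; set b := normc _.
  have : 0 <= (th * a - b) ^+ 2 / th by rewrite divr_ge0 ?sqr_ge0 // ltW.
  have -> : (th * a - b) ^+ 2 / th = th * a ^+ 2 + b ^+ 2 / th - 2 * (a * b).
    by field; rewrite gt_eqF.
  lra.
by rewrite -mulr_suml big_split /= -mulr_sumr -mulr_suml !parseval; lra.
Qed.

(** On the Fourier side a shift by [t] gives the factor [1 - chi e t], and [k] averages over [T - T]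
    give a 2k-th power; [W] bounds the product. The coefficient of [A] is bounded by [#|A|], those
    of [L] and [M] by Cauchy-Schwarz. *)
Lemma smoothed_conv_shift (A L M T : {set G}) (k : nat) (t : G) (W th : R) :
  (0 < #|T|)%N -> 0 < th -> 0 <= W ->
  (forall e, normc (1 - chi e t) * (normc (\sum_(x in T) chi e x) / #|T|%:R) ^+ (2 * k) <= W) ->
  let F := iter k (avg (setX T T) (fun p => p.1 - p.2))
             (conv (indic R A) (conv (indic R L) (indic R M))) in
  forall x, `|F (x + t) - F x| <= #|A|%:R * (W * ((th * #|L|%:R + #|M|%:R / th) / 2)).
Proof.
move=> T0 th0 W0 HW F x.
have TR : #|T|%:R != 0 :> R[i] by rewrite pnatr_eq0 -lt0n.
pose c e := fourier A e * (fourier L e * (fourier M e / #|E|%:R)).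
pose b e := (\sum_(p in setX T T) chi e (p.1 - p.2)) / #|setX T T|%:R.
have FE y : (F y)%:C = \sum_e c e * b e ^+ k * chi e y.
  apply: (iter_avg_trig _ _ k chi_char) => z.
  by apply: conv_indic_trig => {}z; apply: conv_indic_trig => {}z; apply: indic_trig.
have nT : normc (#|T|%:R : R[i]) = #|T|%:R.
  by rewrite -(rmorph_nat (real_complex R)) normc_realC ger0_norm.
have nE : normc (#|E|%:R : R[i]) = #|E|%:R.
  by rewrite -(rmorph_nat (real_complex R)) normc_realC ger0_norm.
have bE e : normc (b e) = (normc (\sum_(x in T) chi e x) / #|T|%:R) ^+ 2.
  have -> : b e = ((\sum_(x in T) chi e x) / #|T|%:R) * ((\sum_(x in T) chi e x)^* / #|T|%:R).
    rewrite /b cardsX natrM mulf_div; congr (_ / _).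
    rewrite rmorph_sum /= mulr_suml.
    under [RHS]eq_bigr do rewrite mulr_sumr.
    rewrite pair_big /=; apply: eq_big => [[y z]|[y z] _]; first by rewrite in_setX.
    by rewrite /= -[X in _ = _ * X]/(conjc (chi e z)) character_conj // -(chi_char e).2.
  by rewrite !normcM normc_conj normcV nT expr2.
rewrite -normc_realC.
have -> : (F (x + t) - F x)%:C = (F (x + t))%:C - (F x)%:C by exact: rmorphB.
rewrite !FE -sumrB.
apply: le_trans (normc_sum _ _ _) _.
apply: le_trans (_ : \sum_e #|A|%:R * (W * (normc (fourier L e) * normc (fourier M e) / #|E|%:R)) <= _).
  apply: ler_sum => e _; rewrite -mulrBr (chi_char e).2.
  have -> : chi e x * chi e t - chi e x = - chi e x * (1 - chi e t) by ring.
  rewrite !normcM normcN character_normc // mul1r normcX bE -exprM normcV nE.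
  have nA : normc (fourier A e) <= #|A|%:R.
    apply: le_trans (normc_sum _ _ _) _; rewrite -sumr_const; apply: ler_sum => a _.
    by rewrite character_normc.
  rewrite -!mulrA; apply: ler_pM => //; rewrite ?mulr_ge0 ?normc_ge0 ?invr_ge0 ?exprn_ge0 //.
    by rewrite divr_ge0 ?normc_ge0.
  rewrite !mulrA [leRHS]mulrC !mulrA [leLHS]mulrC mulrA [leRHS]mulrC.
  have := HW e; set u := _ ^+ _ => {}HW.
  rewrite [X in X <= _](_ : _ = normc (1 - chi e t) * u *
     (normc (fourier L e) * normc (fourier M e) / #|E|%:R)); last by ring.
  rewrite [X in _ <= X](_ : _ = W *
     (normc (fourier L e) * normc (fourier M e) / #|E|%:R)); last by ring.
  by apply: ler_wpM2r => //; rewrite divr_ge0 ?mulr_ge0 ?normc_ge0.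
rewrite -!mulr_sumr -mulr_suml; do 2 (apply: ler_wpM2l => //).
rewrite ler_pdivrMr ?ltr0n // mulrC [leRHS]mulrC.
by rewrite mulrC; apply: cauchy_schwarz_fourier.
Qed.

End Fourier.

(** * Almost periodicity by sampling *)

Section CrootSisask.
Variables (R : realType) (G : finZmodType).

(** The left side is convex in [p] and lies below its chord from 0 to 1. A bound linear in [p] is
    what lets the densities sum to [#|L|]. *)
Lemma pow_convex (v p : R) m : 0 <= v -> 0 <= p <= 1 ->
  (1 + v * p) ^+ m - 1 <= p * ((1 + v) ^+ m - 1).
Proof.
move=> v0 /andP[p0 p1]; elim: m => [|m IH]; first by rewrite !expr0 subrr mulr0.
rewrite !exprS; set X := (1 + v) ^+ m in IH *; set Y := (1 + v * p) ^+ m in IH *.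
have X1 : 0 <= X - 1 by rewrite subr_ge0 exprn_ege1 // lerDl.
have vp : 0 <= v * p by rewrite mulr_ge0.
have h1 : (1 + v * p) * (Y - 1) <= (1 + v * p) * (p * (X - 1)).
  by rewrite ler_wpM2l // addr_ge0.
have h2 : 0 <= v * p * (1 - p) * (X - 1) by rewrite !mulr_ge0 // subr_ge0.
nra.
Qed.

Lemma conv_comm (f g : G -> R) x : conv f g x = conv g f x.
Proof.
rewrite /conv (reindex_inj (can_inj (subKr x))) /=.
by apply: eq_bigr => t _; rewrite subKr mulrC.
Qed.

Lemma sum_indic_sub (X : {set G}) y : \sum_x indic R X (x - y) = #|X|%:R.
Proof.
rewrite (reindex_inj (addIr y)) -sumr_const [RHS]big_mkcond /=.
by apply: eq_bigr => x _; rewrite addrK /indic; case: (x \in X).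
Qed.

Lemma cosh_ge0 y : 0 <= expR y + expR (- y) - 2 :> R.
Proof. by have := expR_ge1Dx y; have := expR_ge1Dx (- y); lra. Qed.

(** The sum factors over the [m] independent coordinates, and in each the linear term has mean
    zero. *)
Lemma exp_moment (A : {set G}) (z : G -> R) (s p : R) (m : nat) :
  (forall a, `|z a| <= 1) -> \sum_(a in A) z a = 0 ->
  \sum_(a in A) z a ^+ 2 <= #|A|%:R * p -> `|s| <= 1 / 3 ->
  \sum_(h in ffun_on (mem A)) expR (s * \sum_(j < m) z (h j)) <=
    (#|A|%:R * (1 + s ^+ 2 * p)) ^+ m.
Proof.
move=> z1 z0 z2 s3.
under eq_bigr do rewrite mulr_sumr expR_sum.
rewrite -(bigA_distr_big (fun a => a \in A) (fun (_ : 'I_m) a => expR (s * z a))) /=.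
rewrite prodr_const card_ord; apply: lerXn2r; rewrite ?nnegrE.
- by apply: sumr_ge0 => a _; apply: expR_ge0.
- apply: le_trans (_ : \sum_(a in A) (s * z a) ^+ 2 + #|A|%:R <= _).
    by rewrite addr_ge0 // sumr_ge0 // => a _; rewrite sqr_ge0.
  under eq_bigr do rewrite exprMn.
  rewrite -mulr_sumr; have := ler_wpM2l (sqr_ge0 s) z2; lra.
apply: le_trans (_ : \sum_(a in A) (1 + s * z a + s ^+ 2 * z a ^+ 2) <= _).
  apply: ler_sum => a _; rewrite -exprMn; apply: expR_le_quadratic.
  by rewrite normrM; apply: le_trans s3; rewrite ler_piMr.
rewrite !big_split /= -!mulr_sumr z0 sumr_const mulr0 addr0.
have := ler_wpM2l (sqr_ge0 s) z2; lra.
Qed.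

Section Sampling.
Variables (A L : {set G}) (lam : R) (m : nat).
Hypothesis A0 : (0 < #|A|)%N.
Hypothesis lam0 : 0 < lam <= 1 / 3.

Let AR : 0 < #|A|%:R :> R. Proof. by rewrite ltr0n. Qed.

Definition density (x : G) : R := (\sum_(a in A) indic R L (x - a)) / #|A|%:R.

Definition deviation (h : {ffun 'I_m -> G}) (x : G) : R :=
  \sum_(j < m) (indic R L (x - h j) - density x).

(** The [- 2] makes each term vanish where the deviation does, so the total is governed by [#|L|]
    instead of [#|G|]. *)
Definition potential (h : {ffun 'I_m -> G}) : R :=
  \sum_x (expR (lam * deviation h x) + expR (- (lam * deviation h x)) - 2).

Lemma density_itv x : 0 <= density x <= 1.
Proof.
apply/andP; split; first by rewrite divr_ge0 // sumr_ge0 // => a _; rewrite ler0n.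
rewrite ler_pdivrMr // mul1r -sumr_const; apply: ler_sum => a _.
by rewrite /indic; case: (_ \in _).
Qed.

Lemma sum_density : \sum_x density x = #|L|%:R.
Proof.
rewrite -mulr_suml exchange_big /=.
under eq_bigr do rewrite sum_indic_sub.
by rewrite sumr_const -[X in X / _]mulr_natr mulfK ?gt_eqF.
Qed.

Lemma sum_potential :
  \sum_(h in ffun_on (mem A)) potential h <=
    2 * #|A|%:R ^+ m * ((1 + lam ^+ 2) ^+ m * #|L|%:R).
Proof.
rewrite exchange_big /= -sum_density [X in _ <= _ * X]mulr_sumr [leRHS]mulr_sumr; apply: ler_sum => x _.
have /andP[lam_gt0 lam3] := lam0.
have /andP[p0 p1] := density_itv x; set p := density x in p0 p1 *.
pose z a : R := indic R L (x - a) - p.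
have z1 a : `|z a| <= 1.
  by rewrite /z /indic ler_norml; case: (_ \in _) => /=; lra.
have sum_ind : \sum_(a in A) indic R L (x - a) = #|A|%:R * p.
  by rewrite /p /density mulrC divfK ?gt_eqF.
have z0 : \sum_(a in A) z a = 0.
  by rewrite sumrB sum_ind sumr_const mulr_natl subrr.
have z2 : \sum_(a in A) z a ^+ 2 <= #|A|%:R * p.
  rewrite -sum_ind; apply: le_trans (_ : \sum_(a in A) (indic R L (x - a) * (1 - 2 * p) + p ^+ 2) <= _).
    by apply: ler_sum => a _; rewrite /z /indic !expr2; case: (_ \in _) => /=; lra.
  rewrite big_split /= -mulr_suml sum_ind sumr_const -mulr_natl expr2.
  have : 0 <= #|A|%:R * (p * p) by rewrite mulr_ge0 ?ler0n // mulr_ge0.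
  lra.
have mom s : `|s| = lam -> \sum_(h in ffun_on (mem A)) expR (s * deviation h x) <=
    #|A|%:R ^+ m * (1 + lam ^+ 2 * p) ^+ m.
  move=> sl; rewrite -exprMn -sl.
  have -> : `|s| ^+ 2 = s ^+ 2 by rewrite real_normK ?num_real.
  by apply: (@exp_moment A z s p m) => //; rewrite sl.
have m2 := mom lam (gtr0_norm lam_gt0).
have m1 : \sum_(h in ffun_on (mem A)) expR (- (lam * deviation h x)) <=
    #|A|%:R ^+ m * (1 + lam ^+ 2 * p) ^+ m.
  under eq_bigr do rewrite -mulNr.
  by apply: mom; rewrite normrN (gtr0_norm lam_gt0).
rewrite sumrB big_split /= sumr_const card_ffun_on card_ord.
have Am : 0 <= #|A|%:R ^+ m :> R by rewrite exprn_ge0.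
have := ler_wpM2l Am (pow_convex m (sqr_ge0 lam) (density_itv x)).
have : 0 <= #|A|%:R ^+ m * p by rewrite mulr_ge0.
rewrite -/p -[2 *+ _]mulr_natl natrX; lra.
Qed.

(** The threshold is twice the mean allowed by [sum_potential], so Markov keeps at least half of the
    tuples when [L] is nonempty. *)
Definition good_samples : {set {ffun 'I_m -> G}} :=
  [set h in ffun_on (mem A) | potential h <= 4 * ((1 + lam ^+ 2) ^+ m * #|L|%:R)].

Lemma card_good_samples : (0 < #|L|)%N -> (#|A|%:R : R) ^+ m <= 2 * #|good_samples|%:R.
Proof.
move=> L0; set W := (1 + lam ^+ 2) ^+ m * #|L|%:R.
have W0 : 0 < W.
  rewrite mulr_gt0 ?ltr0n // exprn_gt0 //.
  by have := sqr_ge0 lam; lra.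
have pot0 h : 0 <= potential h by apply: sumr_ge0 => x _; apply: cosh_ge0.
have Acard : #|(ffun_on (mem A) : pred {ffun 'I_m -> G})|%:R = #|A|%:R ^+ m :> R.
  by rewrite card_ffun_on card_ord natrX.
have : (4 * W) * (#|A|%:R ^+ m - #|good_samples|%:R) <= 2 * #|A|%:R ^+ m * W.
  apply: le_trans sum_potential; rewrite -Acard.
  apply: le_trans (_ : \sum_(h in ffun_on (mem A)) (4 * W * (1 - (h \in good_samples)%:R)) <= _).
    rewrite -mulr_sumr; apply: ler_wpM2l; first by rewrite mulr_ge0 // ltW.
    rewrite sumrB sumr_const lerD2l lerN2.
    rewrite -sumr_const big_mkcond [leRHS]big_mkcond; apply: ler_sum => h _ /=.
    by case: ifP; case: ifP.
  apply: ler_sum => h hA; rewrite inE hA /=.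
  by case: (lerP (potential h) (4 * W)) => [_|/ltW] /=; rewrite ?subrr ?mulr0 ?subr0 ?mulr1.
by move=> H; rewrite -(ler_pM2l W0); lra.
Qed.

(** Each pair of [s] in [S] and a good tuple gives a translate with entries in [A + S]; by
    pigeonhole some tuple [g] arises from many pairs. *)
Lemma common_translates (S : {set G}) :
  exists g : {ffun 'I_m -> G},
    (#|S| * #|good_samples| <= #|sumset A S| ^ m *
       #|[set s in S | [ffun j => (g j - s)%R] \in good_samples]|)%N.
Proof.
pose T (g : {ffun 'I_m -> G}) := [set s in S | [ffun j => (g j - s)] \in good_samples].
have [g _ gmax] := @arg_maxnP _ [ffun=> 0] xpredT (fun g => #|T g|) isT.
exists g; rewrite -/(T g).
pose D : pred {ffun 'I_m -> G} := ffun_on (mem (sumset A S)).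
have -> : (#|sumset A S| ^ m = #|D|)%N by rewrite card_ffun_on card_ord.
rewrite -[X in (_ <= X)%N]sum_nat_const; apply: leq_trans (_ : \sum_(f in D) #|T f| <= _)%N; last first.
  by apply: leq_sum => f _; apply: gmax.
rewrite -[X in (X <= _)%N]sum_nat_const.
under [X in (_ <= X)%N]eq_bigr do rewrite -sum1_card big_mkcond /=.
rewrite exchange_big /= [X in (X <= _)%N]big_mkcond; apply: leq_sum => s _ /=.
case: ifP => sS; last by [].
pose sh (h : {ffun 'I_m -> G}) : {ffun 'I_m -> G} := [ffun j => h j + s].
have sh_inj : injective sh.
  by move=> h h' /ffunP H; apply/ffunP => j; have := H j; rewrite !ffunE => /addIr.
rewrite -(card_imset _ sh_inj) -sum1_card big_mkcond [X in (_ <= X)%N]big_mkcond /=.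
apply: leq_sum => f _; case: ifP => // /imsetP[h hG ->].
have -> : sh h \in D.
  apply/ffun_onP => j; rewrite ffunE; apply/imset2P; exists (h j) s => //.
  by move: hG; rewrite inE => /andP[/ffun_onP/(_ j)].
rewrite inE sS /=.
have -> : [ffun j => sh h j - s] = h by apply/ffunP => j; rewrite !ffunE addrK.
by rewrite hG.
Qed.

End Sampling.

(** Sampling [F] at [x - t] along the good tuple [g - t] is the same as sampling at [x] along [g],
    which does not depend on [t]. So all translates by [T] are close to one function [H]. *)
Lemma croot_sisask (A S L M : {set G}) (K eps : R) (m : nat) :
  let eta : R := #|M|%:R / #|L|%:R in
  (0 < #|A|)%N -> (0 < #|M|)%N -> (0 < #|L|)%N -> eta <= 1 ->
  0 < eps <= 1 / 2 -> #|sumset A S|%:R <= K * #|A|%:R ->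
  4 * ln (6 / eta) / eps ^+ 2 <= m%:R ->
  exists2 T : {set G}, T \subset S /\ #|S|%:R <= 2 * K ^+ m * #|T|%:R &
    exists H : G -> R, forall t x, t \in T ->
      `|conv (indic R A) (conv (indic R L) (indic R M)) (x - t) - H x|
         <= eps * #|A|%:R * #|M|%:R.
Proof.
move=> eta A0 M0 L0 eta1 /andP[eps0 eps1] doub mbig.
have [AR MR LR] : [/\ 0 < #|A|%:R :> R, 0 < #|M|%:R :> R & 0 < #|L|%:R :> R].
  by rewrite !ltr0n.
have eta0 : 0 < eta by rewrite divr_gt0.
(* With [ln (6 / eta) <= lam^2 m] the exponent [c] below is at most [2 lam^2 m], a mean error of
   [2 lam = eps] per sample. *)
set lam := eps / 2; have lam0 : 0 < lam by rewrite divr_gt0.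
have lam01 : 0 < lam <= 1 / 3 by rewrite /lam; lra.
have six : 1 < 6 / eta by rewrite ltr_pdivlMr //; lra.
have ln0 : 0 < ln (6 / eta) by rewrite ln_gt0.
have mlam : ln (6 / eta) <= lam ^+ 2 * m%:R.
  move: mbig; rewrite ler_pdivrMr ?exprn_gt0 // /lam !expr2; lra.
have m0 : 0 < m%:R :> R.
  apply: lt_le_trans mbig; rewrite divr_gt0 ?exprn_gt0 ?mulr_gt0 //.
have [g gP] := @common_translates A L lam m S.
set T := [set s in S | _] in gP; exists T.
  split; first by apply/subsetP => s; rewrite inE => /andP[].
  have := card_good_samples m A0 lam01 L0.
  set gd := #|good_samples A L lam m| in gP * => gdP.
  have Am : 0 < #|A|%:R ^+ m :> R by rewrite exprn_gt0.
  have h1 : #|S|%:R * gd%:R <= #|sumset A S|%:R ^+ m * #|T|%:R :> R.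
    by rewrite -natrX -!natrM ler_nat.
  have h2 : #|sumset A S|%:R ^+ m <= K ^+ m * #|A|%:R ^+ m :> R.
    rewrite -exprMn lerXn2r ?nnegrE //; exact: le_trans doub.
  have h3 := ler_wpM2r (ler0n R #|T|) h2.
  have h4 := ler_wpM2l (ler0n R #|S|) gdP.
  by rewrite -(ler_pM2r Am); lra.
exists (fun x => #|A|%:R / m%:R * \sum_(y in M) \sum_(j < m) indic R L (x - y - g j)).
move=> t x; rewrite inE => /andP[_]; set h := [ffun j => _]; rewrite inE => /andP[_ hpot].
set F := conv _ _.
pose Z y := deviation A L h (x - t - y).
set H := _ * \sum_(y in M) _.
have ZE : \sum_(y in M) Z y = m%:R / #|A|%:R * (H - F (x - t)).
  have -> : F (x - t) = #|A|%:R * \sum_(y in M) density A L (x - t - y).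
    rewrite /F conv_indicE.
    under eq_bigr do rewrite conv_comm conv_indicE.
    rewrite exchange_big mulr_sumr; apply: eq_bigr => y _ /=.
    rewrite /density mulrC divfK ?gt_eqF //; apply: eq_bigr => a _.
    by congr (indic _ _ _); rewrite addrAC.
  have alg (a b X Y : R) : a != 0 -> b != 0 -> b / a * (a / b * X - a * Y) = X - b * Y.
    by move=> a0 b0; field; rewrite a0 b0.
  rewrite /H alg ?gt_eqF //.
  rewrite mulr_sumr -sumrB; apply: eq_bigr => y _.
  rewrite /Z /deviation sumrB sumr_const card_ord mulr_natl; congr (_ - _).
  apply: eq_bigr => j _; congr (indic _ _ _); rewrite ffunE.
  by rewrite opprB addrA [_ + t]addrC !addrA [t + x]addrC addrK.
have sumphi : \sum_(y in M) (expR (lam * Z y) + expR (- (lam * Z y)) - 2) <=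
    4 * (expR (lam ^+ 2 * m%:R) * #|L|%:R).
  apply: le_trans (le_trans hpot _); last first.
    rewrite ler_wpM2l // ler_wpM2r // expRM_natr lerXn2r ?nnegrE ?expR_ge0 //.
      by rewrite addr_ge0 ?sqr_ge0.
    exact: expR_ge1Dx.
  rewrite /potential [leRHS](reindex_inj (can_inj (subKr (x - t)))) /= big_mkcond /=.
  by apply: ler_sum => y _; case: ifP => _; [exact: lexx | exact: cosh_ge0].
(* Jensen over [M], with [c] the mean of [s * lam * Z], gives [expR c <= (6 / eta) expR (lam^2 m)];
   the 6 is 4 + 2, using [#|M| <= #|L|]. *)
have key s : s = 1 \/ s = -1 -> s * (H - F (x - t)) <= eps * #|A|%:R * #|M|%:R.
  move=> s1.
  pose c := s * lam * (m%:R / #|A|%:R * (H - F (x - t))) / #|M|%:R.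
  have : #|M|%:R * expR c <= \sum_(y in M) expR (s * lam * Z y).
    apply: sum_expR_ge; rewrite -mulr_sumr ZE /c mulrC divfK ?gt_eqF //.
  have h1 : \sum_(y in M) expR (s * lam * Z y) <=
      \sum_(y in M) ((expR (lam * Z y) + expR (- (lam * Z y)) - 2) + 2).
    apply: ler_sum => y _; rewrite subrK; case: s1 => ->.
      by rewrite mul1r lerDl expR_ge0.
    by rewrite mulN1r mulNr lerDr expR_ge0.
  rewrite big_split /= sumr_const -[2 *+ _]mulr_natr in h1.
  move=> h2; have {h1 h2 sumphi} : #|M|%:R * expR c <=
      4 * (expR (lam ^+ 2 * m%:R) * #|L|%:R) + 2 * #|M|%:R by lra.
  have e1 : 1 <= expR (lam ^+ 2 * m%:R) :> R.
    by have := expR_ge1Dx (lam ^+ 2 * m%:R); have := mulr_ge0 (sqr_ge0 lam) (ltW m0); lra.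
  have LM : #|M|%:R <= #|L|%:R :> R by move: eta1; rewrite /eta ler_pdivrMr // mul1r.
  have h3 : #|M|%:R * 1 <= #|L|%:R * expR (lam ^+ 2 * m%:R) by apply: ler_pM.
  move=> h2; have {h2} : expR c <= expR (ln (6 / eta) + lam ^+ 2 * m%:R).
    rewrite expRD lnK; last by rewrite posrE; lra.
    have -> : 6 / eta * expR (lam ^+ 2 * m%:R) =
        (6 * (#|L|%:R * expR (lam ^+ 2 * m%:R))) / #|M|%:R.
      by rewrite /eta; field; rewrite !gt_eqF.
    by rewrite ler_pdivlMr //; lra.
  rewrite ler_expR => cle.
  have {cle} : c <= 2 * (lam ^+ 2 * m%:R) by lra.
  rewrite /c ler_pdivrMr //.
  have q0 : 0 < lam * m%:R / #|A|%:R by exact: divr_gt0 (mulr_gt0 lam0 m0) AR.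
  move=> cle; rewrite -(ler_pM2l q0).
  rewrite [leLHS](_ : _ = s * lam * (m%:R / #|A|%:R * (H - F (x - t)))); last by ring.
  rewrite [leRHS](_ : _ = 2 * (lam ^+ 2 * m%:R) * #|M|%:R) //.
  by rewrite /lam; field; rewrite ?gt_eqF.
have := key 1 (or_introl erefl); have := key (-1) (or_intror erefl).
by rewrite mul1r mulN1r ler_norml => k1 k2; apply/andP; split; lra.
Qed.

End CrootSisask.

(** * Choice of parameters *)

Section IteratedConvolution.
Variables (R : realType) (G : finZmodType) (A : nat -> {set G}).
Implicit Type f : G -> R.

Let step := fun i f => conv (indic R (A i)) f.

(** Brings [A 1], the outermost factor of [iter_conv], next to [L] and [M]. *)
Lemma conv_foldr_swap (X : {set G}) f s x :
  conv (indic R X) (foldr step f s) x = foldr step (conv (indic R X) f) s x.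
Proof.
elim: s x => [|i s IH] x //=; rewrite /step !conv_indicE.
under eq_bigr do rewrite conv_indicE.
rewrite exchange_big; apply: eq_bigr => a _ /=.
rewrite -IH conv_indicE; apply: eq_bigr => b _.
by rewrite addrAC.
Qed.

Lemma foldr_conv_dist f (e : R) t s : (forall x, `|f (x + t) - f x| <= e) ->
  forall x, `|foldr step f s (x + t) - foldr step f s x| <= (\prod_(i <- s) #|A i|%:R) * e.
Proof.
move=> fe; elim: s => [|i s IH] x /=; first by rewrite big_nil mul1r.
rewrite /step !conv_indicE -sumrB; apply: le_trans (ler_norm_sum _ _ _) _.
rewrite big_cons -mulrA mulr_natl -sumr_const; apply: ler_sum => a _.
by rewrite addrAC; exact: IH.
Qed.

Lemma sup_norm_le f (e : R) : 0 <= e -> (forall x, `|f x| <= e) -> sup_norm f <= e.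
Proof. by move=> e0 fe; apply: bigmax_le. Qed.

Lemma iter_conv_dist (n : nat) (L M : {set G}) (c : R) t : (0 < n)%N -> 0 <= c ->
  let F1 := conv (indic R (A 1%N)) (conv (indic R L) (indic R M)) in
  (forall x, `|F1 (x + t) - F1 x| <= c * #|A 1%N|%:R * #|M|%:R) ->
  sup_norm (fun x => iter_conv R A n L M (x + t) - iter_conv R A n L M x)
    <= c * (\prod_(i <- iota 1 n) #|A i|%:R) * #|M|%:R.
Proof.
case: n => // n _ c0 F1 F1P.
apply: sup_norm_le => [|x]; first by rewrite !mulr_ge0 ?prodr_ge0.
rewrite /iter_conv /= !conv_foldr_swap.
apply: le_trans (foldr_conv_dist _ F1P _) _.
by rewrite big_cons; lra.
Qed.

End IteratedConvolution.

Section LogBounds.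
Variable R : realType.

Lemma expR1_le4 : expR 1 <= 4 :> R.
Proof.
have h : expR (1 / 3) <= 13 / 9 :> R.
  apply: le_trans (expR_le_quadratic _) _; last by rewrite expr2; lra.
  by rewrite ger0_norm //; lra.
have -> : (1 : R) = 3%:R * (1 / 3) by lra.
rewrite expRM_natl; apply: le_trans (lerXn2r 3 _ _ h) _; rewrite ?nnegrE ?expR_ge0 //.
  by lra.
by rewrite !exprS expr0; lra.
Qed.

Lemma ln2_ge : 1 / 2 <= ln 2 :> R.
Proof.
rewrite -(expRK (1 / 2 : R)) ler_ln ?posrE ?expR_gt0 //.
have h : expR (1 / 2) ^+ 2 <= 4 :> R.
  by rewrite -expRM_natl; apply: le_trans expR1_le4; rewrite ler_expR; lra.
have h2 : (2 : R) = Num.sqrt 4.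
  by rewrite (_ : 4 = 2 ^+ 2) ?sqrtr_sqr ?ger0_norm //; rewrite expr2; lra.
by rewrite [leRHS]h2 -[leLHS]ger0_norm ?expR_ge0 // -sqrtr_sqr ler_wsqrtr.
Qed.

Lemma ln_le_compat (x y : R) : 0 < x -> x <= y -> ln x <= ln y.
Proof. by move=> x0 xy; rewrite ler_ln ?posrE //; apply: lt_le_trans xy. Qed.

Lemma exists_nat_itv (x : R) : 0 <= x ->
  exists n : nat, [/\ (0 < n)%N, x < n%:R & n%:R <= x + 1].
Proof.
move=> /truncn_itv/andP[h1 h2]; exists (Num.truncn x).+1.
by split=> //; rewrite -natr1 lerD2r.
Qed.

Definition log_cost (eps eta K sigma : R) : R :=
  eps ^- 2 * ln (2 / (eps * eta)) ^+ 2 * ln (2 / eta) * ln (2 * K) + ln (1 / sigma).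

Lemma log_factors (eps eta K sigma : R) :
  0 < eps < 1 -> 0 < eta <= 1 -> 1 <= K -> 0 < sigma <= 1 ->
  [/\ 1 / 2 <= ln (2 / (eps * eta)), 1 / 2 <= ln (2 / eta), 1 / 2 <= ln (2 * K),
      0 <= ln (1 / sigma) &
      1 / 8 <= eps ^- 2 * ln (2 / (eps * eta)) ^+ 2 * ln (2 / eta)].
Proof.
move=> /andP[e0 e1] /andP[h0 h1] K1 /andP[s0 s1].
have big (x : R) : 2 <= x -> 1 / 2 <= ln x.
  by move=> x2; apply: le_trans ln2_ge _; apply: ln_le_compat.
have ee : 0 < eps * eta by rewrite mulr_gt0.
have ee1 : eps * eta <= 1 by rewrite mulr_ile1 // ltW.
have a1 : 1 / 2 <= ln (2 / (eps * eta)) by apply: big; rewrite ler_pdivlMr //; lra.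
have a2 : 1 / 2 <= ln (2 / eta) by apply: big; rewrite ler_pdivlMr //; lra.
have a3 : 1 <= eps ^- 2 :> R.
  by rewrite invf_ge1 ?exprn_gt0 // exprn_ile1 // ltW.
split=> //; first by apply: big; lra.
  by rewrite ln_ge0 // ler_pdivlMr //; lra.
have a4 : 1 / 4 <= ln (2 / (eps * eta)) ^+ 2 by rewrite expr2; nra.
have a5 : 1 / 4 <= eps ^- 2 * ln (2 / (eps * eta)) ^+ 2.
  by apply: le_trans a4 _; rewrite ler_peMl // sqr_ge0.
set y := _ * _ in a5 *; nra.
Qed.

(** Serves the case where the Bohr set is kept: [d' >= 1] then suffices for the width inequality. *)
Lemma log_cost_ge (eps eta K sigma : R) :
  0 < eps < 1 -> 0 < eta <= 1 -> 1 <= K -> 0 < sigma <= 1 ->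
  1 <= 3360 * (500 * 400) * log_cost eps eta K sigma.
Proof.
move=> h1 h2 h3 h4; have [_ _ lK ls Pge] := log_factors h1 h2 h3 h4.
rewrite /log_cost; set P := eps ^- 2 * _ * _ in Pge *.
have : (1 / 8) * (1 / 2) <= P * ln (2 * K) by apply: ler_pM => //; lra.
by lra.
Qed.

End LogBounds.

(** * Almost periods for a single set [A] *)

Section Core.
Variable R : realType.
Variables (G : finZmodType) (eps rho K : R) (A S M L : {set G}) (Gam : seq {ffun G -> R[i]}).
Hypothesis eps01 : 0 < eps < 1.
Hypothesis Gam_freq : freq_set Gam.
Hypothesis Gam0 : (0 < size Gam)%N.
Hypothesis rho02 : 0 < rho <= 2.
Hypothesis reg : regular_Bohr Gam rho.
Hypothesis K1 : 1 <= K.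
Hypothesis SB : S \subset Bohr Gam rho.
Hypothesis doub : #|sumset A S|%:R <= K * #|A|%:R.

Let B := Bohr Gam rho.
Let sigma : R := #|S|%:R / #|B|%:R.
Let eta : R := #|M|%:R / #|L|%:R.
Let F := conv (indic R A) (conv (indic R L) (indic R M)).
Let d : R := (size Gam)%:R.

Hypothesis sigma0 : 0 < sigma.
Hypothesis eta0 : 0 < eta.
Hypothesis eta1 : eta <= 1.
Hypothesis A0 : (0 < #|A|)%N.

Let Gc g (gG : g \in Gam) : is_character g := Gam_freq.2 g gG.

Let dR : 0 < d. Proof. by rewrite ltr0n. Qed.

Let B0 : 0 < #|B|%:R :> R.
Proof. by rewrite ltr0n Bohr_card_gt0 //; case/andP: rho02 => /ltW. Qed.

Lemma regular_Bohr_doubling :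
  #|Bohr Gam (rho * (1 + 1 / (12 * d)))|%:R <= 2 * #|B|%:R :> R.
Proof.
have d12 : 0 < 12 * d by rewrite mulr_gt0.
have [|_] := reg (delta := 1 / (12 * d)).
  by rewrite ger0_norm // divr_ge0 // ltW.
rewrite ler_pdivrMr // ger0_norm; last by rewrite divr_ge0 // ltW.
by rewrite -/d mul1r mulfV ?gt_eqF // -/B.
Qed.

Lemma sigma_le1 : sigma <= 1.
Proof. by rewrite ler_pdivrMr // mul1r ler_nat subset_leq_card. Qed.

(* [k1] is the number of copies of [T - T] over which [F] is averaged, [k] bounds the number of
   new frequencies. *)
Lemma almost_period_spectrum : exists (T : {set G}) (k1 k : nat),
  [/\ T \subset B, (0 < #|T|)%N,
      (forall x i, i \in setX T T ->
         `|F (x + (i.1 - i.2)) - F x| <= 2 * (eps / (8 * k1%:R) * #|A|%:R * #|M|%:R)),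
      (0 < k1)%N /\ 2 * (1 / 2) ^+ (2 * k1) <= eps * Num.sqrt eta / 2 &
      [/\ (0 < k)%N, 4 * #|B|%:R < #|T|%:R * expR (k%:R / 16) :> R &
      k%:R <= 500 * 400 * log_cost eps eta K sigma]].
Proof.
have [e0 e1] := andP eps01.
have [M0 L0] : (0 < #|M|)%N /\ (0 < #|L|)%N.
  rewrite !lt0n; split; apply: contraTneq eta0 => z0; rewrite /eta z0.
    by rewrite mul0r ltxx.
  by rewrite invr0 mulr0 ltxx.
have [l1 l2 lK ls Pge] := log_factors eps01 (introT andP (conj eta0 eta1)) K1
  (introT andP (conj sigma0 sigma_le1)).
set ell1 := ln (2 / (eps * eta)) in l1 Pge *.
set ell2 := ln (2 / eta) in l2 Pge *.
(* This gives [4 ^ k1 >= (2 / (eps * eta)) ^ 2 >= 4 / (eps * sqrt eta)], as the smallness of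
   [2 * (1/2) ^ (2 k1)] requires. *)
have [k1 [k10 k1a k1b]] : exists n : nat, [/\ (0 < n)%N, 2 * ell1 < n%:R & n%:R <= 2 * ell1 + 1].
  by apply: exists_nat_itv; lra.
have k1R : 0 < k1%:R :> R by rewrite ltr0n.
(* Each of the [k1] averages moves [F] by at most [2 e'] in units of [#|A| * #|M|], hence [eps / 4]
   in total. *)
pose e' := eps / (8 * k1%:R).
have e'0 : 0 < e' by rewrite divr_gt0 // mulr_gt0.
have e'1 : e' <= 1 / 2.
  rewrite ler_pdivrMr ?mulr_gt0 //.
  have : 1 <= k1%:R :> R by rewrite ler1n.
  lra.
have six : 1 <= 6 / eta.
  by rewrite ler_pdivlMr // mul1r; apply: le_trans eta1 _; lra.
have ln6 : 0 <= ln (6 / eta) by apply: ln_ge0.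
pose mm := 4 * ln (6 / eta) / e' ^+ 2.
have mm0 : 0 <= mm by rewrite divr_ge0 ?sqr_ge0 // mulr_ge0.
have [m [_ ma mb]] := exists_nat_itv mm0.
have [|T [TS Tcard] [H HP]] :=
  @croot_sisask R G A S L M K e' m A0 M0 L0 eta1 _ doub (ltW ma).
  by rewrite e'0.
have S0 : 0 < #|S|%:R :> R.
  by move: sigma0; rewrite /sigma pmulr_lgt0 // invr_gt0.
have T0 : (0 < #|T|)%N.
  rewrite lt0n; apply: contraTneq S0 => z0.
  by rewrite -leNgt; move: Tcard; rewrite z0 mulr0.
have TR : 0 < #|T|%:R :> R by rewrite ltr0n.
(* Any [k > kk] satisfies the largeness condition on [T] in [chang_spectrum]. *)
pose kk : R := 16 * ln (4 * #|B|%:R / #|T|%:R).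
have TB : T \subset B := subset_trans TS SB.
have q4 : 1 <= 4 * #|B|%:R / #|T|%:R :> R.
  rewrite ler_pdivlMr // mul1r -natrM ler_nat.
  by apply: leq_trans (subset_leq_card TB) _; rewrite leq_pmull.
have kk0 : 0 <= kk by rewrite mulr_ge0 ?ln_ge0.
have [k [k0 ka kb]] := exists_nat_itv kk0.
exists T, k1, k; split=> //.
- move=> x [t1 t2] /setXP[t1T t2T] /=.
  (* [F x] and [F (x + t1 - t2)] are both compared with [H (x + t1)]. *)
  have h1 := HP t1 (x + t1) t1T; have := HP t2 (x + t1) t2T.
  rewrite addrK in h1; rewrite addrA => h2; rewrite -/F in h1 h2.
  rewrite distrC in h1.
  have -> : F (x + t1 - t2) - F x = (F (x + t1 - t2) - H (x + t1)) + (H (x + t1) - F x).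
    ring.
  apply: le_trans (ler_normD _ _) _; rewrite -/e'; lra.
- split=> //.
  have e14 : expR (k1%:R) <= 4 ^+ k1 :> R.
    rewrite -[k1%:R]mulr1 expRM_natl lerXn2r ?nnegrE ?expR_ge0 //.
    exact: expR1_le4.
  have h4 : (2 / (eps * eta)) ^+ 2 <= 4 ^+ k1.
    apply: le_trans e14; rewrite -[2 / _]lnK; last first.
      by rewrite posrE divr_gt0 // mulr_gt0.
    by rewrite -expRM_natl ler_expR ltW.
  have se : eta <= Num.sqrt eta.
    rewrite -{1}[eta](sqr_sqrtr (ltW eta0)) expr2 ler_piMl ?sqrtr_ge0 //.
    by rewrite -[leRHS]sqrtr1 ler_wsqrtr.
  have s0 : 0 < Num.sqrt eta by rewrite sqrtr_gt0.
  have p4 : 0 < 4 ^+ k1 :> R by rewrite exprn_gt0.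
  have -> : (1 / 2) ^+ (2 * k1) = (4 ^+ k1)^-1 :> R.
    by rewrite exprM -exprVn; congr (_ ^+ _); rewrite expr2; lra.
  rewrite ler_pdivrMr //.
  have ee : 0 < eps * eta by rewrite mulr_gt0.
  have es : 0 < eps * Num.sqrt eta by rewrite mulr_gt0.
  have : 4 / (eps * Num.sqrt eta) <= 4 ^+ k1.
    apply: le_trans h4; rewrite exprMn exprVn (_ : 2 ^+ 2 = 4); last by rewrite expr2; lra.
    rewrite ler_wpM2l // lef_pV2 ?posrE //; last by rewrite exprn_gt0.
    have hh : eps * eta <= 1 by rewrite mulr_ile1 // ltW.
    rewrite expr2; apply: le_trans (_ : eps * eta <= _).
      by rewrite ler_piMl // ltW.
    by rewrite ler_wpM2l // ltW.
  rewrite ler_pdivrMr //; lra.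
split=> //.
  have -> : 4 * #|B|%:R = #|T|%:R * expR (kk / 16) :> R.
    have -> : kk / 16 = ln (4 * #|B|%:R / #|T|%:R) by rewrite /kk; lra.
    rewrite lnK ?posrE; last exact: lt_le_trans q4.
    by field; rewrite gt_eqF.
  by rewrite ltr_pM2l // ltr_expR ltr_pM2r ?invr_gt0.
rewrite /log_cost -/ell1 -/ell2.
set P := eps ^- 2 * ell1 ^+ 2 * ell2 in Pge *.
have K0 : 0 < K by apply: lt_le_trans K1.
have lnK0 : 0 <= ln K by apply: ln_ge0.
have lnKK : ln K <= ln (2 * K) by apply: ln_le_compat => //; lra.
(* [256 * 3 * 16 = 12288], and the 1 lost in rounding is at most [8 P]. *)
have m_le : m%:R <= (500 * 24 + 300) * P.
  have k16 : k1%:R ^+ 2 <= 16 * ell1 ^+ 2.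
    have : k1%:R <= 4 * ell1 by lra.
    move=> h; have -> : 16 * ell1 ^+ 2 = (4 * ell1) ^+ 2 by rewrite !expr2; lra.
    by rewrite lerXn2r ?nnegrE //; lra.
  have l6 : ln (6 / eta) <= 3 * ell2.
    have p2 : 0 < 2 / eta by exact: divr_gt0.
    have <- : ln ((2 / eta) ^+ 3) = 3 * ell2 by rewrite (lnXn _ p2) [RHS]mulr_natl.
    apply: ln_le_compat; first by rewrite divr_gt0.
    have w1 : 1 <= eta^-1 by rewrite invf_ge1.
    have w2 : eta^-1 <= eta^-1 ^+ 3 by rewrite -[leLHS]expr1 ler_weXn2l.
    rewrite exprMn; apply: le_trans (_ : 6 * eta^-1 ^+ 3 <= _); first by rewrite ler_wpM2l.
    rewrite ler_wpM2r ?exprn_ge0 ?(le_trans ler01 w1) //.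
    by rewrite !exprS expr0; lra.
  have mmE : mm = 4 * 64 * (ln (6 / eta) * k1%:R ^+ 2) * eps ^- 2.
    by rewrite /mm /e'; field; rewrite !gt_eqF.
  have : ln (6 / eta) * k1%:R ^+ 2 <= (3 * ell2) * (16 * ell1 ^+ 2).
    by apply: ler_pM; rewrite ?sqr_ge0.
  have en : 0 <= eps ^- 2 :> R by rewrite invr_ge0 sqr_ge0.
  move=> /(ler_wpM2r en); move: mb Pge; rewrite mmE /P.
  move: (eps ^- 2) (ln (6 / eta)) (k1%:R ^+ 2) (ell1 ^+ 2) => w l x y ? ? ?.
  lra.
(* From [#|S| <= 2 K^m #|T|] and [#|S| = sigma #|B|], the argument is at most [8 K^m / sigma]. *)
have lnq : ln (4 * #|B|%:R / #|T|%:R) <= 3 * ln 2 + m%:R * ln K + ln (1 / sigma).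
  have Km : 0 < K ^+ m by rewrite exprn_gt0.
  rewrite [3 * _]mulr_natl [m%:R * _]mulr_natl -!lnXn // -!lnM ?posrE ?divr_gt0 ?mulr_gt0 ?exprn_gt0 //.
  apply: ln_le_compat; first by rewrite divr_gt0 ?mulr_gt0.
  rewrite ler_pdivrMr // /sigma.
  have -> : 2 ^+ 3 * K ^+ m * (1 / (#|S|%:R / #|B|%:R)) * #|T|%:R =
    4 * #|B|%:R * (2 * K ^+ m * #|T|%:R) / #|S|%:R.
    by rewrite !exprS expr0; field; rewrite !gt_eqF.
  by rewrite ler_pdivlMr // ler_wpM2l // mulr_ge0.
have h1 : m%:R * ln K <= (500 * 24 + 300) * P * ln (2 * K).
  by apply: ler_pM.
have h2 : 1 / 8 * ln (2 * K) <= P * ln (2 * K) by rewrite ler_wpM2r // (le_trans _ lK) // divr_ge0.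
have h3 : ln 2 <= ln (2 * K) :> R by apply: ln_le_compat => //; rewrite ler_peMr.
move: kb lnq h1 h2 h3 lK ls; rewrite /kk.
move: (ln (4 * #|B|%:R / #|T|%:R)) (m%:R * ln K) (ln 2 : R) (ln (1 / sigma)) (k%:R : R).
by clear Pge m_le; move: P (ln (2 * K)) => P lnK x y z s q *; lra.
Qed.

Lemma core_bohr_set : exists (Gam' : seq {ffun G -> R[i]}) (rho' : R) (k : nat),
  [/\ freq_set Gam', 0 < rho' <= 2, Bohr Gam' rho' \subset B,
      (forall t, t \in Bohr Gam' rho' -> forall x,
         `|F (x + t) - F x| <= eps * #|A|%:R * #|M|%:R) &
   [/\ rho * eps * Num.sqrt eta = rho' * (d ^+ 2 * (3360 * k%:R)),
       (size Gam' <= size Gam + k)%N &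
       k%:R <= 500 * 400 * log_cost eps eta K sigma]].
Proof.
have [e0 e1] := andP eps01; have [rho0 rho2] := andP rho02.
have [T [k1 [k [TB T0 Tper [k10 k1small] [k0 Tbig kle]]]]] := almost_period_spectrum.
have [E [chi [E0 chi_char chi_orth]]] := dual_orthogonality R G.
have s0 : 0 < Num.sqrt eta by rewrite sqrtr_gt0.
have s1 : Num.sqrt eta <= 1 by rewrite -[leRHS]sqrtr1 ler_wsqrtr.
have es1 : eps * Num.sqrt eta <= 1 by rewrite mulr_ile1 // ltW.
have es0 : 0 < eps * Num.sqrt eta by rewrite mulr_gt0.
(* Chosen so that [2 * nu] equals the bound [eps * sqrt eta / 2] met by characters with small
   coefficient. *)
pose nu : R := eps * Num.sqrt eta / 4.
have nu0 : 0 < nu by rewrite divr_gt0.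
have nu01 : 0 < nu <= 1 by rewrite nu0 /nu; lra.
have [Lam Lk LamP] := chang_spectrum chi_char Gc Gam0 rho0 regular_Bohr_doubling
  TB k0 Tbig nu01.
have kR : 0 < k%:R :> R by rewrite ltr0n.
have k1R : 0 < k1%:R :> R by rewrite ltr0n.
have k1' : 1 <= k%:R :> R by rewrite ler1n.
have d1 : 1 <= d by rewrite ler1n.
have d2 : 1 <= d ^+ 2 by rewrite exprn_ege1.
have TR : 0 < #|T|%:R :> R by rewrite ltr0n.
(* The width [chang_spectrum] asks for on [Gam]; being at most [nu / k], it also serves the new
   frequencies. The 3360 is [840 * 4]. *)
pose rho' := rho * nu / (840 * d ^+ 2 * k%:R).
have den0 : 0 < 840 * d ^+ 2 * k%:R by rewrite !mulr_gt0 ?exprn_gt0.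
have rho'0 : 0 < rho' by exact: divr_gt0 (mulr_gt0 rho0 nu0) den0.
have rho'nu : rho' <= nu / k%:R.
  rewrite /rho' ler_pdivrMr // (_ : nu / k%:R * _ = nu * (840 * d ^+ 2)); last first.
    by field; rewrite gt_eqF.
  rewrite mulrC (ler_wpM2l (ltW nu0)) // (le_trans rho2) //.
  apply: le_trans (_ : 840 * 1 <= _); first by rewrite mulr1 ler_nat.
  by rewrite ler_wpM2l.
have rho'rho : rho' <= rho.
  rewrite /rho' ler_pdivrMr // ler_wpM2l ?(ltW rho0) //.
  have /andP[_ nu1] := nu01; apply: le_trans nu1 _.
  by apply: mulr_ege1 => //; apply: mulr_ege1; rewrite ?ler1n.
pose Gam' := undup (Gam ++ [seq chi l | l <- enum Lam]).
have GamG' : {subset Gam <= Gam'} by move=> g gG; rewrite mem_undup mem_cat gG.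
exists Gam', rho', k; split.
- split; first exact: undup_uniq.
  move=> g; rewrite mem_undup mem_cat => /orP[/Gc//|/mapP[l _ ->]].
  exact: chi_char.
- by rewrite rho'0 (le_trans rho'rho).
- exact: subset_trans (Bohr_subseq _ GamG') (Bohr_le _ rho'rho).
- move=> t tB x.
  have tG : t \in Bohr Gam (rho * nu / (840 * d ^+ 2 * k%:R)).
    exact: subsetP (Bohr_subseq _ GamG') _ tB.
  have tL l : l \in Lam -> normc (1 - chi l t) <= nu / k%:R.
    move=> lL; apply: le_trans rho'nu; move/BohrP: tB; apply.
    by rewrite mem_undup mem_cat map_f ?orbT // mem_enum.
  have chi2 e : normc (1 - chi e t) <= 2.
    by apply: le_trans (le_normcD _ _) _; rewrite normcN character_normc // normc1 -natr1.
  have ratio1 e : normc (\sum_(x in T) chi e x) / #|T|%:R <= 1.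
    rewrite ler_pdivrMr // mul1r; apply: le_trans (normc_sum _ _ _) _.
    by rewrite -sumr_const; apply: ler_sum => y _; rewrite character_normc.
  have ratio0 e : 0 <= normc (\sum_(x in T) chi e x) / #|T|%:R.
    by rewrite divr_ge0 ?normc_ge0.
  have e2nu : 2 * nu = eps * Num.sqrt eta / 2 by rewrite /nu; field.
  (* For a large coefficient [chi e t] is near 1; otherwise [|1 - chi e t| <= 2] and the averages
     supply [(1/2) ^ (2 k1)]. *)
  have WP e : normc (1 - chi e t) *
      (normc (\sum_(x in T) chi e x) / #|T|%:R) ^+ (2 * k1) <= eps * Num.sqrt eta / 2.
    case: (lerP (#|T|%:R / 2) (normc (\sum_(x in T) chi e x))) => [spec|nspec].
      have := LamP e t spec tG tL => h.
      apply: le_trans (_ : normc (1 - chi e t) <= _); last by rewrite -e2nu.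
      by rewrite ler_piMr ?normc_ge0 // exprn_ile1.
    apply: le_trans k1small; apply: ler_pM; rewrite ?normc_ge0 ?exprn_ge0 //.
    rewrite lerXn2r ?nnegrE //; first by rewrite divr_ge0.
    by rewrite ler_pdivrMr // mul1r mulrC ltW.
  have W0 : 0 <= eps * Num.sqrt eta / 2 by rewrite divr_ge0 ?(ltW es0).
  have := smoothed_conv_shift E0 chi_char chi_orth A L M T0 s0 W0 WP x.
  rewrite -/F; set F' := iter k1 _ F => h.
  have close := iter_avg_dist (v := fun p : G * G => p.1 - p.2) _ k1 Tper.
  have XT0 : (0 < #|setX T T|)%N by rewrite cardsX muln_gt0 T0.
  have {close} close y := close XT0 y; rewrite -/F' in close.
  have c1 := close (x + t); have c2 := close x; rewrite distrC in c1.
  (* The choice [th = sqrt eta] equalizes the two Cauchy-Schwarz terms, and the [sqrt eta] in [W]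
     cancels. *)
  have LMs : (Num.sqrt eta * #|L|%:R + #|M|%:R / Num.sqrt eta) / 2 = #|M|%:R / Num.sqrt eta.
    have -> : #|L|%:R = #|M|%:R / eta.
      rewrite /eta invf_div mulrCA mulfV ?mulr1 //.
      by apply: contraTneq eta0 => z0; rewrite /eta z0 mul0r ltxx.
    rewrite -{2}[eta]sqr_sqrtr ?(ltW eta0) //.
    by field; rewrite gt_eqF.
  rewrite LMs in h.
  have e_half : #|A|%:R * (eps * Num.sqrt eta / 2 * (#|M|%:R / Num.sqrt eta)) =
      eps / 2 * (#|A|%:R * #|M|%:R) by field; rewrite gt_eqF.
  rewrite e_half in h.
  have e_quart : k1%:R * (2 * (eps / (8 * k1%:R) * #|A|%:R * #|M|%:R)) =
      eps / 4 * (#|A|%:R * #|M|%:R) by field; rewrite gt_eqF.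
  rewrite e_quart in c1 c2.
  (* Passing between [F] and its average [F'] costs [eps / 4] at each end, and shifting [F'] costs
     [eps / 2]. *)
  have -> : F (x + t) - F x = (F (x + t) - F' (x + t)) +
     ((F' (x + t) - F' x) + (F' x - F x)) by ring.
  have -> : eps * #|A|%:R * #|M|%:R = eps / 4 * (#|A|%:R * #|M|%:R) +
      (eps / 2 * (#|A|%:R * #|M|%:R) + eps / 4 * (#|A|%:R * #|M|%:R)) by field.
  apply: le_trans (ler_normD _ _) (lerD c1 _).
  exact: le_trans (ler_normD _ _) (lerD h c2).
split=> //.
  by rewrite /rho' /nu; field; rewrite !gt_eqF.
apply: leq_trans (size_undup _) _.
by rewrite size_cat size_map -cardE leq_add2l.
Qed.

End Core.

(** * Assembly for several sets and degenerate cases *)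

Theorem theorem8 (R : realType) :
  exists C : R, 0 < C /\
  forall (G : finZmodType) (eps : R) (n : nat) (A : nat -> {set G}) (M L : {set G})
         (Gam : seq {ffun G -> R[i]}) (rho K : R) (S : {set G}),
    0 < eps < 1 ->
    (0 < n)%N ->
    freq_set Gam -> (0 < size Gam)%N -> 0 < rho <= 2 -> regular_Bohr Gam rho ->
    1 <= K ->
    S \subset Bohr Gam rho ->
    #|sumset (A 1%N) S|%:R <= K * #|A 1%N|%:R ->
    let sigma : R := #|S|%:R / #|Bohr Gam rho|%:R in
    let eta : R := #|M|%:R / #|L|%:R in
    0 < sigma -> eta <= 1 ->
    let F := iter_conv R A n L M in
    exists (Gam' : seq {ffun G -> R[i]}) (rho' d' : R),
      freq_set Gam' /\ 0 < rho' <= 2 /\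
          Bohr Gam' rho' \subset Bohr Gam rho /\
          (forall t, t \in Bohr Gam' rho' ->
             sup_norm (fun x => F (x + t) - F x)
               <= eps * (\prod_(i <- iota 1 n) #|A i|%:R) * #|M|%:R) /\
          rho * eps * Num.sqrt eta <= rho' * ((size Gam)%:R ^+ 2 * d') /\
          (size Gam')%:R <= (size Gam)%:R + d' /\
          0 <= d' /\
          d' <= C * (eps ^- 2 * ln (2 / (eps * eta)) ^+ 2 * ln (2 / eta) * ln (2 * K)
                     + ln (1 / sigma)).
Proof.
exists (3360 * (500 * 400)); split; first by rewrite !mulr_gt0.
move=> G eps n A M L Gam rho K S eps01 n0 Gf G0 rho02 reg K1 SB doub sigma eta s0 eta1 F.
have [e0 e1] := andP eps01; have [rho0 rho2] := andP rho02.
have d1 : 1 <= (size Gam)%:R :> R by rewrite ler1n.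
have d2 : 1 <= (size Gam)%:R ^+ 2 :> R by rewrite exprn_ege1.
have s1 : sigma <= 1.
  by rewrite ler_pdivrMr ?mul1r ?ler_nat ?subset_leq_card // ltr0n Bohr_card_gt0 ?ltW // => g /Gf.2.
have eta0 : 0 <= eta by rewrite divr_ge0.
(* [d'] is the full allowed bound, so [3360 * k <= d'] serves both width and dimension. *)
pose d' := 3360 * (500 * 400) * log_cost eps eta K sigma.
have [/andP[eta_pos A0]|triv] := boolP ((0 < eta) && (0 < #|A 1|)%N).
  have [Gam' [rho' [k [Gf' rho'02 sub per [width dim kle]]]]] :=
    core_bohr_set (A := A 1) eps01 Gf G0 rho02 reg K1 SB doub s0 eta_pos eta1 A0.
  exists Gam', rho', d'; rewrite -/sigma -/eta in kle width.
  have kR : 0 <= k%:R :> R by [].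
  have kd : 3360 * k%:R <= d' by rewrite /d' -mulrA ler_wpM2l.
  do 3![split=> //]; split.
    by move=> t /per; apply: iter_conv_dist => //; exact: ltW.
  split.
    rewrite width; apply: ler_wpM2l; first by case/andP: rho'02 => /ltW.
    by rewrite (ler_wpM2l (le_trans ler01 d2)).
  split; last by split; [exact: le_trans (mulr_ge0 (ler0n _ _) kR) kd | exact: lexx].
  apply: le_trans (_ : (size Gam + k)%:R <= _); first by rewrite ler_nat.
  by rewrite natrD lerD2l (le_trans _ kd) // ler_peMl // ler1n.
(* Here the convolution vanishes identically, so the original Bohr set works. *)
exists Gam, rho, d'.
have cost : rho * eps * Num.sqrt eta <= rho * ((size Gam)%:R ^+ 2 * d') /\ 0 <= d'.
  have [eta_pos|] := ltP 0 eta.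
    have d'1 : 1 <= d'.
      exact: log_cost_ge eps01 (introT andP (conj eta_pos eta1)) K1 (introT andP (conj s0 s1)).
    split; last exact: le_trans d'1.
    rewrite -mulrA ler_wpM2l ?(ltW rho0) //.
    apply: le_trans (_ : 1 <= _).
      rewrite mulr_ile1 ?sqrtr_ge0 ?(ltW e0) ?(ltW e1) //.
      by rewrite -[leRHS]sqrtr1 ler_wsqrtr.
    exact: mulr_ege1.
  (* This covers empty [M] or [L]. With [2 / 0 = 0] and [ln 0 = 0] only [ln (1 / sigma)] survives in
     [d'], and the left side of the width inequality is 0. *)
  move=> eta_le; have -> : eta = 0 by apply: le_anti; rewrite eta_le.
  rewrite sqrtr0 mulr0; have d'0 : 0 <= d'.
    rewrite /d' (_ : eta = 0); last by apply: le_anti; rewrite eta_le.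
    rewrite /log_cost !mulr0 invr0 !mulr0 ln0 // mulr0 mul0r add0r.
    by rewrite !mulr_ge0 // ln_ge0 // ler_pdivlMr // mul1r.
  by split=> //; apply: mulr_ge0 (ltW rho0) _; exact: mulr_ge0 (le_trans ler01 d2) d'0.
have [width d'0] := cost.
do 3![split=> //]; split; last by split=> //; split; [rewrite lerDl | split=> //; exact: lexx].
move=> t _; apply: iter_conv_dist => //; first exact: ltW.
suff F0 x : conv (indic R (A 1%N)) (conv (indic R L) (indic R M)) x = 0.
  by move=> x; rewrite !F0 subr0 normr0 !mulr_ge0 // ltW.
rewrite conv_indicE; move: triv; rewrite negb_and -leNgt -leqNgt leqn0 => /orP[eta_le|].
  have /eqP : eta = 0 by apply: le_anti; rewrite eta_le.
  rewrite mulf_eq0 invr_eq0 !pnatr_eq0 !cards_eq0 => ML.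
  apply: big1 => a _; rewrite conv_indicE; case/orP: ML => /eqP->.
    by apply: big1 => l _; rewrite /indic inE.
  by rewrite big_set0.
by rewrite cards_eq0 => /eqP ->; rewrite big_set0.
Qed.
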